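(* Let $U=V+H$ with $V,H\in C^2(\mathbb R^d)$ be such that $e^{-U}$ is integrable and, for some constants $\alpha,L\ge0$ and $\beta>0$, one has $\alpha I_d\preccurlyeq\nabla^2V\preccurlyeq\beta I_d$ and $|\nabla H|\le L$ on $\mathbb R^d$. Let $(P^{\mathrm{LD}}_t)_{t\ge0}$ be the semigroup of the Langevin dynamics $dX_t=-\nabla U(X_t)\,dt+\sqrt2\,dB_t$. Then for all $T>0$ and $\mu,\nu\in\mathcal P_2(\mathbb R^d)$ $$\mathcal H\left(\mu P^{\mathrm{LD}}_T\,\middle|\,\nu P^{\mathrm{LD}}_T\right)\le\begin{cases}\dfrac{\left(W_2(\mu,\nu)+2LT\right)^2}{4T}&\text{if }\alpha=0,\\[3mm]\dfrac{\alpha}{2\left(1-e^{-2\alpha T}\right)}\left(e^{-\alpha T}W_2(\mu,\nu)+\dfrac{2L}{\alpha}\left(1-e^{-\alpha T}\right)\right)^2&\text{if }\alpha>0.\end{cases}$$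
   Context: $(B_t)_t$ is a standard $d$-dimensional Brownian motion; $\mu P^{\mathrm{LD}}_T$ is the law of $X_T$ when $X_0\sim\mu$. $\mathcal P_2(\mathbb R^d)$ is the set of Borel probability measures on $\mathbb R^d$ with finite second moment and $W_2$ is the 2-Wasserstein distance for the Euclidean metric. The relative entropy is $\mathcal H(\mu\,|\,\pi)=\int\log\left(\frac{d\mu}{d\pi}\right)d\mu$ if $\mu\ll\pi$, and $+\infty$ otherwise. *)

(* Defs.v *)
From HB Require Import structures.
From mathcomp Require Import all_boot all_order all_algebra.
From mathcomp Require Import all_classical all_reals all_analysis measurable_realfun.

Set Implicit Arguments.
Unset Strict Implicit.
Unset Printing Implicit Defensive.

Import Order.TTheory GRing.Theory Num.Theory.
Import numFieldNormedType.Exports.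

Local Open Scope classical_set_scope.
Local Open Scope charge_scope.
Local Open Scope ring_scope.

(* Matrix spaces, hence R^d = 'rV[R]_d, carry the Borel sigma-algebra. *)

Definition borel_mx_display : measure_display. Proof. exact. Qed.

Section borel_mx.
Context {R : realType} {m n : nat}.

Let G : set (set 'M[R]_(m, n)) := <<s open >>.

Let G0 : G set0.
Proof. exact: sigma_algebra0. Qed.

Let GC A : G A -> G (~` A).
Proof. exact: sigma_algebraC. Qed.

Let Gcup (F : _^nat) : (forall i, G (F i)) -> G (\bigcup_i (F i)).
Proof. exact: sigma_algebra_bigcup. Qed.

HB.instance Definition _ :=
  @isMeasurable.Build borel_mx_display 'M[R]_(m, n) G G0 GC Gcup.

End borel_mx.

Section borel_rV.
Context {R : realType}.

Lemma open_measurable_rV n (A : set 'rV[R]_n) : open A -> measurable A.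
Proof. by move=> oA; exact: sub_sigma_algebra. Qed.

Lemma measurable_coord_rV n (i : 'I_n) :
  measurable_fun setT (fun v : 'rV[R]_n => v 0 i).
Proof.
apply: (measurability _ (RGenOInfty.measurableE R)) => _ [_ [x ->] <-].
rewrite setTI; apply: open_measurable_rV.
apply: open_comp; last exact: interval_open.
by move=> v _; exact: coord_continuous.
Qed.

Lemma measurable_fun_rV d (T : measurableType d) n (f : T -> 'rV[R]_n) :
  (forall i, measurable_fun setT (fun x => f x 0 i)) -> measurable_fun setT f.
Proof.
have mE : @measurable _ 'rV[R]_n = <<s open >> by [].
move=> mf; apply: (measurability _ mE) => _ [A oA <-]; rewrite setTI.
pose box (q : 'rV[rat]_n * nat) : set 'rV[R]_n :=
  [set v | forall i, `|ratr (q.1 0 i) - v 0 i| < q.2.+1%:R^-1].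
have -> : A = \bigcup_(q : 'rV[rat]_n * nat)
    (if pselect (box q `<=` A) then box q else set0).
  apply/seteqP; split=> [v Av|v [q _]]; last first.
    by case: pselect => [bA /bA|].
  have /nbhs_ballP[e /= e0 eA] : nbhs v A.
    by apply: open_nbhs_nbhs; split.
  have [k ke] : exists k : nat, k.+1%:R^-1 < e / 2 :> R.
    have e20 : 0 < e / 2 by rewrite divr_gt0.
    have /ltr_add_invr[k] := e20.
    by rewrite add0r => ?; exists k.
  have kgt0 : 0 < k.+1%:R^-1 :> R by rewrite invr_gt0.
  have H i : exists q : rat, `|ratr q - v 0 i| < k.+1%:R^-1.
    have lt2 : v 0 i - k.+1%:R^-1 < v 0 i + k.+1%:R^-1.
      by rewrite ltrD2l gtrN.
    have [q /itvP qP] := rat_in_itvoo lt2.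
    by exists q; rewrite ltr_distl !qP.
  pose q := \row_i (xchoose (H i)).
  exists (q, k) => //; case: pselect => [_ i|].
    by rewrite mxE; exact: (xchooseP (H i)).
  case=> w bw; apply: eA; split => // i0 i; rewrite ord1 /ball/=.
  rewrite (splitr e) -(subrKA (ratr (q 0 i))) (le_lt_trans (ler_normD _ _))//.
  apply: ltrD; apply: lt_trans ke; last exact: (bw i).
  by rewrite distrC mxE; exact: (xchooseP (H i)).
rewrite preimage_bigcup; apply: countable_bigcupT_measurable => // q.
case: pselect => [qA|qA]; last by rewrite preimage_set0.
have -> : f @^-1` box q = \bigcap_(i in [set: 'I_n])
    ((fun x => f x 0 i) @^-1` (ball (ratr (q.1 0 i) : R) q.2.+1%:R^-1)).
  by apply/seteqP; split=> [x bx i _|x bx i]; [exact: bx|exact: (bx i)].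
apply: fin_bigcap_measurable => // i _.
rewrite -[X in measurable X]setTI; apply: mf => //.
exact: measurable_ball.
Qed.

End borel_rV.

Section rV_prod.
Context {R : realType} (n : nat).
Variable m : {sigma_finite_measure set 'rV[R]_n -> \bar R}.

Definition rV_cons (p : R * 'rV[R]_n) : 'rV[R]_n.+1 :=
  row_mx (const_mx p.1 : 'rV[R]_1) p.2.

Lemma rV_cons0 p : rV_cons p 0 0 = p.1.
Proof.
transitivity (rV_cons p 0 (lshift n (0 : 'I_1))).
  by congr (rV_cons _ _ _); exact: val_inj.
by apply: etrans (row_mxEl _ _ _ _) _; rewrite mxE.
Qed.

Lemma rV_consS p i : rV_cons p 0 (lift 0 i) = p.2 0 i.
Proof.
have -> : lift 0 i = rshift 1 i :> 'I_(1 + n) by exact: val_inj.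
exact: row_mxEr.
Qed.

Let rV_uncons (v : 'rV[R]_n.+1) : R * 'rV[R]_n := (v 0 0, \row_i v 0 (lift 0 i)).

Let rV_consK : cancel rV_cons rV_uncons.
Proof.
case=> x v; congr pair; first by rewrite rV_cons0.
by apply/rowP => i; rewrite mxE rV_consS.
Qed.

Let measurable_rV_cons : measurable_fun setT rV_cons.
Proof.
apply: measurable_fun_rV => i; have [j ->|->] := unliftP 0 i.
  rewrite [X in measurable_fun _ X](_ : _ = (fun v : 'rV[R]_n => v 0 j) \o snd).
    by apply: measurableT_comp; [exact: measurable_coord_rV|exact: measurable_snd].
  by apply/funext => p; rewrite rV_consS.
rewrite [X in measurable_fun _ X](_ : _ = fst); first exact: measurable_fst.
by apply/funext => p; rewrite rV_cons0.
Qed.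

Let measurable_rV_uncons : measurable_fun setT rV_uncons.
Proof.
apply: measurable_fun_pair; first exact: measurable_coord_rV.
apply: measurable_fun_rV => i; rewrite [X in measurable_fun _ X](_ : _ =
  fun v : 'rV[R]_n.+1 => v 0 (lift 0 i)); first exact: measurable_coord_rV.
by apply/funext => v; rewrite mxE.
Qed.

HB.instance Definition _ :=
  isMeasurableFun.Build _ _ _ _ rV_cons measurable_rV_cons.

Definition rV_prod : set 'rV[R]_n.+1 -> \bar R :=
  pushforward (@lebesgue_measure R \x m)%E rV_cons.

Let step0 : rV_prod set0 = 0%E.
Proof. exact: measure0. Qed.

Let step_ge0 A : (0 <= rV_prod A)%E.
Proof. exact: measure_ge0. Qed.

Let step_sigma_additive : semi_sigma_additive rV_prod.
Proof. exact: measure_semi_sigma_additive. Qed.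

HB.instance Definition _ :=
  isMeasure.Build _ _ _ rV_prod step0 step_ge0 step_sigma_additive.

Let sigma_finite_step : sigma_finite setT rV_prod.
Proof.
have /sigma_finiteP[F [TF ndF Foo]] := sigma_finiteT (@lebesgue_measure R).
have /sigma_finiteP[G [TG ndG Goo]] := sigma_finiteT m.
exists (fun k => rV_uncons @^-1` (F k `*` G k)).
  rewrite -preimage_bigcup (_ : \bigcup_k (F k `*` G k) = setT) ?preimage_setT//.
  apply/seteqP; split=> // -[x v] _.
  have [i _ Fx] : (\bigcup_k F k) x by rewrite -TF.
  have [j _ Gv] : (\bigcup_k G k) v by rewrite -TG.
  exists (maxn i j) => //; split => /=.
    by move: Fx; exact/subsetPset/ndF/leq_maxl.
  by move: Gv; exact/subsetPset/ndG/leq_maxr.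
move=> k; have [mF Fk] := Foo k; have [mG Gk] := Goo k; split.
  by rewrite -[X in measurable X]setTI; apply: measurable_rV_uncons => //;
    exact: measurableX.
rewrite /rV_prod /pushforward -comp_preimage.
rewrite (_ : rV_uncons \o rV_cons = id); last exact/funext/rV_consK.
by rewrite preimage_id product_measure1E// lte_mul_pinfty// ge0_fin_numE.
Qed.

HB.instance Definition _ :=
  Measure_isSigmaFinite.Build _ _ _ rV_prod sigma_finite_step.

End rV_prod.

Fixpoint lebesgue_rV {R : realType} (n : nat) :
    {sigma_finite_measure set 'rV[R]_n -> \bar R} :=
  match n with
  | 0 => @dirac _ 'rV[R]_0 0 R
  | k.+1 => rV_prod (lebesgue_rV k)
  end.

Lemma lebesgue_rV_box {R : realType} n (A : 'I_n -> set R) :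
  (forall i, measurable (A i)) ->
  lebesgue_rV n [set v | forall i, A i (v 0 i)] =
  (\prod_(i < n) (@lebesgue_measure R (A i)))%E.
Proof.
elim: n A => [|n IH] A mA /=.
  by rewrite big_ord0 diracE mem_set// => -[].
rewrite big_ord_recl -IH// -product_measure1E//; [|exact: mA|]; last first.
  rewrite [X in measurable X](_ : _ = \bigcap_(i in [set: 'I_n])
      ((fun v : 'rV[R]_n => v 0 i) @^-1` A (lift 0 i))).
    apply: fin_bigcap_measurable => // i _.
    by rewrite -[X in measurable X]setTI; exact: measurable_coord_rV.
  by apply/seteqP; split=> [v Av i _|v Av i]; [exact: Av|exact: (Av i)].
rewrite /rV_prod /pushforward; congr (_ _); apply/seteqP; split=> [[x v] /= Av|].
  by split => [|i]; [have := Av 0|have := Av (lift 0 i)];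
    rewrite ?rV_cons0 ?rV_consS.
case=> x v [/= Ax Av] i; have [j ->|->] := unliftP 0 i.
  by rewrite rV_consS; exact: Av.
by rewrite rV_cons0.
Qed.

Section euclidean.
Context {R : realType} {d : nat}.
Implicit Types (x v : 'rV[R]_d) (f : 'rV[R]_d -> R) (A B : 'M[R]_d).

(* The library norm `|x| on 'rV[R]_d is the sup norm. *)
Definition enorm x : R := Num.sqrt (\sum_(i < d) x 0 i ^+ 2).

Definition grad f x : 'rV[R]_d := \row_i 'D_(delta_mx 0 i) f x.

Definition hess f x : 'M[R]_d :=
  \matrix_(i, j) 'D_(delta_mx 0 j) (fun y => grad f y 0 i) x.

Definition C2 f : Prop :=
  [/\ forall x, differentiable f x,
      forall x, differentiable (grad f) x &
      continuous (hess f)].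

Definition loewner_le A B : Prop :=
  forall v, 0 <= (v *m (B - A) *m v^T) 0 0.

End euclidean.

Section measures.
Context {R : realType}.

Definition relative_entropy {dT : measure_display} {T : measurableType dT}
    (mu nu : probability T R) : \bar R :=
  if `[< mu `<< nu >]
  then (\int[mu]_x lne ('d (charge_of_finite_measure mu) '/d nu x))%E
  else +oo%E.

Context {d : nat}.
Implicit Types mu nu : probability 'rV[R]_d R.

Definition P2 mu : Prop := (\int[mu]_x (enorm x ^+ 2)%:E < +oo)%E.

Definition coupling mu nu
    (g : probability ('rV[R]_d * 'rV[R]_d)%type R) : Prop :=
  forall A : set 'rV[R]_d, measurable A -> g (A `*` setT) = mu A /\ g (setT `*` A) = nu A.

Definition W2 mu nu : \bar R :=
  (ereal_inf [set \int[g]_p (enorm (p.1 - p.2) ^+ 2)%:E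
             | g in coupling mu nu] `^ 2^-1)%E.

End measures.

Section langevin.
Context {R : realType} {d : nat}.

Section on_a_probability_space.
Context {dO : measure_display} {Omega : measurableType dO}.
Variable P : probability Omega R.
Implicit Types (F : R -> set (set Omega)) (B X : R -> Omega -> 'rV[R]_d).

(* Processes are indexed by R, but only their times t >= 0 are constrained. *)

Definition filtration F : Prop :=
  (forall t : R, 0 <= t -> sigma_algebra setT (F t) /\ F t `<=` measurable) /\
  (forall s t : R, 0 <= s -> s <= t -> F s `<=` F t).

Definition adapted F X : Prop :=
  forall t : R, 0 <= t -> forall A : set 'rV[R]_d, measurable A -> F t (X t @^-1` A).

Definition continuous_paths X : Prop :=
  \forall w \ae P, {within `[0, +oo[, continuous (fun t => X t w)}.

Definition has_law (Z : Omega -> 'rV[R]_d) (mu : probability 'rV[R]_d R) : Prop :=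
  forall A : set 'rV[R]_d, measurable A -> P (Z @^-1` A) = mu A.

Definition increment X (s t : R) : Omega -> 'rV[R]_d :=
  fun w => X t w - X s w.

(* The normal law N(0, (t - s) I_d) of B_t - B_s is given by its values on
   boxes; [normal_prob] is parameterized by the standard deviation. *)
Record brownian_motion F B : Prop := BrownianMotion {
  bm_filtration : filtration F ;
  bm_adapted : adapted F B ;
  bm_start : \forall w \ae P, B 0 w = 0 ;
  bm_continuous : continuous_paths B ;
  bm_indep : forall s t : R, 0 <= s -> s <= t ->
    forall (E : set Omega) (A : set 'rV[R]_d), F s E -> measurable A ->
    P (E `&` increment B s t @^-1` A) = (P E * P (increment B s t @^-1` A))%E ;
  bm_normal : forall s t : R, 0 <= s -> s < t ->
    forall A : 'I_d -> set R, (forall i, measurable (A i)) ->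
    P [set w | forall i, A i (increment B s t w 0 i)] =
    (\prod_(i < d) normal_prob 0 (Num.sqrt (t - s)) (A i))%E }.

(* Since the noise is additive, the integral form of
   dX_t = - grad U (X_t) dt + sqrt 2 dB_t involves no stochastic integral. *)
Record langevin_solution (U : 'rV[R]_d -> R) F B X : Prop := LangevinSolution {
  ls_brownian : brownian_motion F B ;
  ls_adapted : adapted F X ;
  ls_continuous : continuous_paths X ;
  ls_equation : \forall w \ae P, forall t : R, 0 <= t -> forall i,
    X t w 0 i = X 0 w 0 i
      - \int[@lebesgue_measure R]_(s in `[0, t]) grad U (X s w) 0 i
      + Num.sqrt 2 * B t w 0 i }.

End on_a_probability_space.

(* [S t mu] is the law mu P_t of X_t when X_0 has law mu. *)
Definition langevin_semigroup (U : 'rV[R]_d -> R)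
    (S : R -> probability 'rV[R]_d R -> probability 'rV[R]_d R) : Prop :=
  forall mu, exists (dO : measure_display) (Omega : measurableType dO)
      (P : probability Omega R) (F : R -> set (set Omega))
      (B X : R -> Omega -> 'rV[R]_d),
    [/\ langevin_solution P U F B X,
        has_law P (X 0) mu &
        forall t : R, 0 <= t -> has_law P (X t) (S t mu)].

End langevin.

(* Main.v *)
(* The relative entropy is bounded through its Donsker-Varadhan dual: it suffices to prove the
   log-Harnack inequality [P_T f x <= K (|x - y|) + ln (P_T (expR f) y)] for bounded continuous
   [f], integrate it against an arbitrary coupling of [mu] and [nu], and minimize over couplings.
   No Girsanov transform is needed: since locally Lipschitz drifts make the Euler scheme converge
   along every Brownian path, the inequality only has to be proved for the Euler chain with step
   [h = T / N.+1], where the change of measure is a finite product of Gaussian shifts. The gradient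
   step of [V] contracts by [rho = exp (- alpha (1 - h beta / 2) h)] and the step of [H] separates
   two points by at most [2 L h], so two chains driven by the same noise can be merged in [N.+1]
   steps by shifting the noise of one of them, and optimizing the shifts yields the cost
   [(rho^N.+1 r + 2 L h sum_k rho^k)^2 / (4 h sum_k rho^(2k))], which converges to the stated one. *)

From HB Require Import structures.
Require Import Defs.
From mathcomp Require Import all_boot all_order all_algebra.
From mathcomp Require Import all_classical all_reals all_analysis measurable_realfun.
From mathcomp Require Import ring lra.

Set Implicit Arguments.
Unset Strict Implicit.
Unset Printing Implicit Defensive.

Import Order.TTheory GRing.Theory Num.Theory.
Import numFieldNormedType.Exports.

Local Open Scope classical_set_scope.
Local Open Scope ring_scope.

(** [langevin_semigroup] supplies, for each initial law, some solution on its own probability space: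
    the diffusions started from [mu] and [nu] cannot be compared path by path, and no transition
    kernel from a point is at hand. The Euler operator is such a kernel. Hence the pointwise
    inequality is proved and integrated against a coupling at the level of the chains, and the step
    tends to 0 only afterwards, one initial law at a time. This limit sees continuous test functions
    only, which is why an extension to bounded measurable ones precedes the entropy bound. The field
    [grad H] is bounded but has no global Lipschitz constant, so its contribution to the gap of two
    chains is additive and does not shrink with the gap; two values of norm at most [L] differ by at
    most [2 * L]. The resulting cost is the square of an affine function of the distance, whereas a
    coupling is controlled through its second moment. The cross term is therefore linearized at the
    transport cost [w] ([sqr_cost_split]), where it is exact, so that nothing is lost. *)

(** * Bounded measurable functions, their means, Jensen and Fubini *)

Section bounded_measurable.
Context {dT : measure_display} {T : measurableType dT} {R : realType}.
Implicit Types (f g : T -> R) (P : probability T R).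

(** Such functions are integrable against every probability, so that linearity and monotonicity of
    real-valued means carry no further integrability conditions. *)
Definition bmeas f : Prop :=
  measurable_fun setT f /\ exists M : R, forall x, `|f x| <= M.

Lemma bmeas_cst (c : R) : bmeas (fun=> c).
Proof. by split; [exact: measurable_cst|exists `|c|]. Qed.

Lemma bmeasD f g : bmeas f -> bmeas g -> bmeas (fun x => f x + g x).
Proof.
move=> [mf [M fM]] [mg [N gN]]; split; first exact: measurable_funD.
by exists (M + N) => x; rewrite (le_trans (ler_normD _ _))// lerD.
Qed.

Lemma bmeasM f g : bmeas f -> bmeas g -> bmeas (fun x => f x * g x).
Proof.
move=> [mf [M fM]] [mg [N gN]]; split; first exact: measurable_funM.
by exists (M * N) => x; rewrite normrM ler_pM.
Qed.

Lemma bmeasZ (c : R) f : bmeas f -> bmeas (fun x => c * f x).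
Proof. by move=> bf; apply: bmeasM => //; exact: bmeas_cst. Qed.

Lemma bmeasN f : bmeas f -> bmeas (fun x => - f x).
Proof.
move=> [mf [M fM]]; split; first exact: measurableT_comp.
by exists M => x; rewrite normrN.
Qed.

Lemma bmeasB f g : bmeas f -> bmeas g -> bmeas (fun x => f x - g x).
Proof. by move=> bf bg; apply: bmeasD => //; exact: bmeasN. Qed.

Lemma bmeas_norm f : bmeas f -> bmeas (fun x => `|f x|).
Proof.
move=> [mf [M fM]]; split; first exact: measurableT_comp.
by exists M => x; rewrite normr_id.
Qed.

Lemma bmeas_itv f (a b : R) : measurable_fun setT f ->
  (forall x, a <= f x <= b) -> bmeas f.
Proof.
move=> mf fab; split => //; exists (`|a| + `|b|) => x.
have /andP[ax xb] := fab x.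
have := ler_norm b; have := ler_norm (- a); rewrite normrN => na nb.
have := normr_ge0 a; have := normr_ge0 b => b0 a0.
by rewrite ler_norml; apply/andP; split; lra.
Qed.

Lemma bmeas_integrable P f : bmeas f -> P.-integrable setT (EFin \o f).
Proof.
move=> [mf [M fM]]; apply: measurable_bounded_integrable => //.
  by rewrite [X in (X < _)%E](_ : _ = 1%E) ?ltry//; exact: probability_setT.
exists M; split; first by rewrite num_real.
by move=> y My x _ /=; rewrite (le_trans (fM x))// ltW.
Qed.

Lemma mean_cst P (c : R) : \int[P]_x c = c.
Proof.
rewrite Rintegral_cst// [X in fine X](_ : _ = 1%E) ?mulr1//.
exact: probability_setT.
Qed.

Lemma meanD P f g : bmeas f -> bmeas g ->
  \int[P]_x (f x + g x) = \int[P]_x f x + \int[P]_x g x.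
Proof. by move=> bf bg; rewrite RintegralD//; exact: bmeas_integrable. Qed.

Lemma meanB P f g : bmeas f -> bmeas g ->
  \int[P]_x (f x - g x) = \int[P]_x f x - \int[P]_x g x.
Proof. by move=> bf bg; rewrite RintegralB//; exact: bmeas_integrable. Qed.

Lemma meanZ P (c : R) f : bmeas f -> \int[P]_x (c * f x) = c * \int[P]_x f x.
Proof. by move=> bf; rewrite RintegralZl//; exact: bmeas_integrable. Qed.

Lemma le_mean P f g : bmeas f -> bmeas g -> (forall x, f x <= g x) ->
  \int[P]_x f x <= \int[P]_x g x.
Proof. by move=> bf bg fg; apply: le_Rintegral => //; exact: bmeas_integrable. Qed.

Lemma mean_itv P f (a b : R) : bmeas f -> (forall x, a <= f x <= b) ->
  a <= \int[P]_x f x <= b.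
Proof.
move=> bf fab; rewrite -[X in X <= _ <= _](mean_cst P) -[X in _ <= _ <= X](mean_cst P).
by apply/andP; split; apply: le_mean => //; try exact: bmeas_cst;
  move=> x; case/andP: (fab x).
Qed.

Lemma EFin_mean P f : bmeas f -> (\int[P]_x f x)%:E = (\int[P]_x (f x)%:E)%E.
Proof.
move=> bf; rewrite /Rintegral fineK//; apply: integrable_fin_num => //.
exact: bmeas_integrable.
Qed.

End bounded_measurable.

Section bmeas_comp.
Context {d1 d2 : measure_display} {T1 : measurableType d1}
  {T2 : measurableType d2} {R : realType}.

Lemma bmeas_comp (f : T2 -> R) (phi : T1 -> T2) :
  bmeas f -> measurable_fun setT phi -> bmeas (f \o phi).
Proof.
move=> [mf [M fM]] mphi; split; first exact: measurableT_comp.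
by exists M => x /=.
Qed.

Lemma mean_law (P : probability T1 R) (m : probability T2 R) (Z : T1 -> T2)
    (f : T2 -> R) : measurable_fun setT Z ->
  (forall A, measurable A -> P (Z @^-1` A) = m A) -> bmeas f ->
  \int[P]_w f (Z w) = \int[m]_x f x.
Proof.
move=> mZ PZ bf; have iZ := bmeas_integrable P (bmeas_comp bf mZ).
congr fine; have -> : (\int[P]_w (f (Z w))%:E =
    \int[pushforward P Z]_x (f x)%:E)%E.
  rewrite integral_pushforward//; apply/measurable_EFinP; exact: bf.1.
by apply: eq_measure_integral => A mA _; exact: PZ.
Qed.

End bmeas_comp.

Section bmeas_real.
Context {dT : measure_display} {T : measurableType dT} {R : realType}.
Implicit Types (f : T -> R) (P : probability T R).

Lemma bmeas_expR f : bmeas f -> bmeas (fun x => expR (f x)).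
Proof.
move=> [mf [M fM]]; apply: (@bmeas_itv _ _ _ _ 0 (expR M)).
  exact: measurableT_comp.
by move=> x; rewrite expR_ge0 ler_expR (le_trans (ler_norm _)).
Qed.

Lemma bmeas_ln f (c : R) : 0 < c -> (forall x, c <= f x) -> bmeas f ->
  bmeas (fun x => ln (f x)).
Proof.
move=> c0 cf [mf [M fM]]; apply: (@bmeas_itv _ _ _ _ (ln c) (ln M)).
  apply: measurableT_comp => //; exact: measurable_ln.
move=> x; rewrite !ler_ln ?posrE ?cf//=; first by rewrite (le_trans (ler_norm _)).
- exact: lt_le_trans (cf x).
- by rewrite (lt_le_trans c0)// (le_trans (cf x))// (le_trans (ler_norm _)).
exact: lt_le_trans (cf x).
Qed.

(** The tangent at [c] of a concave function. It yields Jensen's inequality, the entropy inequality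
    for Gaussian shifts and the stability of [ln] under small errors. *)
Lemma ln_le_div (c x : R) : 0 < c -> 0 < x -> ln x <= ln c + (x / c - 1).
Proof.
move=> c0 x0; rewrite -lerBlDl -ln_div ?posrE//.
by have := @le_ln1Dx R (x / c - 1); rewrite addrCA subrr addr0; apply;
  rewrite ltrBDl subrr divr_gt0.
Qed.

Lemma mean_ln_le P f (c : R) : 0 < c -> (forall x, c <= f x) -> bmeas f ->
  \int[P]_x ln (f x) <= ln (\int[P]_x f x).
Proof.
move=> c0 cf bf; set E := \int[P]_x f x.
have E0 : 0 < E.
  apply: (lt_le_trans c0); rewrite -(mean_cst P c); apply: le_mean => //.
  exact: bmeas_cst.
have bEf : bmeas (fun x => E^-1 * f x) by exact: bmeasZ.
(* The integrand on the right is the tangent of [ln] at the mean [E], evaluated at [f x]. *)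
have -> : ln E = \int[P]_x (ln E - 1 + E^-1 * f x).
  rewrite meanD//; last exact: bmeas_cst.
  by rewrite mean_cst meanZ// mulVf ?gt_eqF// subrK.
apply: le_mean; [exact: (bmeas_ln c0)|by apply: bmeasD => //; exact: bmeas_cst|].
move=> x; rewrite -addrA [- 1 + _]addrC [_^-1 * _]mulrC; apply: ln_le_div => //.
exact: lt_le_trans (cf x).
Qed.

End bmeas_real.

Section fubini.
Context {d1 d2 : measure_display} {T1 : measurableType d1}
  {T2 : measurableType d2} {R : realType}.
Variables (P1 : probability T1 R) (P2 : probability T2 R) (f : T1 * T2 -> R).
Hypothesis bf : bmeas f.

Lemma bmeas_slice x : bmeas (fun y => f (x, y)).
Proof.
split; last by have [M fM] := bf.2; exists M.
exact: (measurableT_comp bf.1 (pair1_measurable x)).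
Qed.

Lemma bmeas_fubini : bmeas (fun x => \int[P2]_y f (x, y)).
Proof.
have [M fM] := bf.2.
apply: (@bmeas_itv _ _ _ _ (- M) M).
  apply: measurableT_comp => //.
  apply: (@measurable_fubini_F _ _ _ _ _ P1 P2 (EFin \o f)).
  exact: bmeas_integrable.
move=> x; apply: mean_itv; first exact: bmeas_slice.
by move=> y; rewrite -ler_norml.
Qed.

Lemma mean_prod : \int[(P1 \x P2)%E]_p f p = \int[P1]_x \int[P2]_y f (x, y).
Proof.
rewrite /Rintegral -(@integral12_prod_meas1 _ _ _ _ _ P1 P2 (EFin \o f)).
  congr fine; apply: eq_integral => x _.
  by rewrite -/(Rintegral _ _ _) EFin_mean//; exact: bmeas_slice.
exact: bmeas_integrable.
Qed.

End fubini.

Local Open Scope charge_scope.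

(** * Gaussian shifts *)

Section gauss1.
Context {R : realType}.
Implicit Types (a s : R) (f : R -> R).
Local Notation leb := (@lebesgue_measure R).

Lemma measurable_addl a : measurable_fun setT (fun x : R => x + a).
Proof. exact: measurable_funD. Qed.

(** Lebesgue measure is determined by its values on half-open intervals, and a translation preserves
    their lengths. *)
Lemma lebesgue_shift a (A : set R) : measurable A ->
  leb ((fun x => x + a) @^-1` A) = leb A.
Proof.
move=> mA; have mf := measurable_addl a.
pose phi : measurableTypeR R -> measurableTypeR R := fun x => x + a.
have mphi : measurable_fun setT phi := mf.
apply/esym; pose nu := measure_function_pushforward__canonical__measure_function_Measure leb mphi.
apply: (@lebesgue_measure_unique R nu _ A mA) => _ [[u v] _ <-]; rewrite /pushforward.
rewrite /nu /= /pushforward.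
have -> : phi @^-1` `](u, v).1, (u, v).2] = `]u - a, v - a]%classic.
  by apply/seteqP; split => x; rewrite /= !in_itv/= ltrBlDr lerBrDr.
rewrite !lebesgue_measure_itv/= !lte_fin ltrD2r.
by case: ifP => // _; rewrite -!EFinD; congr EFin; ring.
Qed.

Lemma integrable_normal_pdfM a s f : bmeas f ->
  leb.-integrable setT (EFin \o (fun x => f x * normal_pdf a s x)).
Proof.
move=> [mf [M fM]].
have ipdf := @integrable_normal_pdf R a s.
have := integrableZl measurableT M ipdf.
apply: le_integrable => //.
  by apply/measurable_EFinP; apply: measurable_funM => //; exact: measurable_normal_pdf.
move=> x _ /=; rewrite lee_fin !normrM ler_wpM2r//.
by rewrite (le_trans (fM x))// ler_norm.
Qed.

(** The Radon-Nikodym derivative of [normal_prob] and [normal_pdf] have the same integral over every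
    measurable set, hence agree almost everywhere. *)
Lemma mean_normal a s f : bmeas f ->
  \int[normal_prob a s]_x f x = \int[leb]_x (f x * normal_pdf a s x).
Proof.
move=> bf; have dom := @normal_prob_dominates R a s.
congr fine; rewrite -(Radon_Nikodym_change_of_variables dom)//; last first.
  exact: bmeas_integrable.
have mfE : measurable_fun setT (EFin \o f) by apply/measurable_EFinP; exact: bf.1.
have mpdf : measurable_fun setT (fun x => (normal_pdf a s x)%:E).
  by apply/measurable_EFinP; exact: measurable_normal_pdf.
apply: ae_eq_integral => //.
- by apply: emeasurable_funM.
- by apply/measurable_EFinP; apply: measurable_funM; [exact: bf.1|exact: measurable_normal_pdf].
have : ae_eq leb setT ('d (charge_of_finite_measure (normal_prob a s)) '/d leb)
    (fun x => (normal_pdf a s x)%:E).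
  apply: integral_ae_eq => //; first exact: Radon_Nikodym_integrable.
  move=> A _ mA; by rewrite -Radon_Nikodym_integral.
by apply: filterS => x h _ /=; rewrite EFinM -h.
Qed.

Lemma mean_normal_shift a s f : s != 0 -> bmeas f ->
  \int[normal_prob 0 s]_x f (x + a) = \int[normal_prob a s]_x f x.
Proof.
move=> s0 bf; have mf := measurable_addl a.
rewrite (mean_normal a s bf) (mean_normal 0 s (bmeas_comp bf mf)).
have i0 := integrable_normal_pdfM 0 s (bmeas_comp bf mf).
have mg : measurable_fun setT (EFin \o (fun x => f x * normal_pdf a s x)).
  by apply/measurable_EFinP; apply: measurable_funM; [exact: bf.1|exact: measurable_normal_pdf].
have E : ((EFin \o (fun x => f x * normal_pdf a s x)) \o (fun x => x + a)) =
   EFin \o (fun x => (f \o (fun x => x + a)) x * normal_pdf 0 s x).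
  apply/funext => x /=; congr (_ * _)%:E.
  by rewrite /normal_pdf (negPf s0) /normal_fun addrK subr0.
pose phi : measurableTypeR R -> measurableTypeR R := fun x => x + a.
have mphi : measurable_fun setT phi := mf.
pose nu := measure_function_pushforward__canonical__measure_function_Measure leb mphi.
congr fine; apply/esym; transitivity (\int[nu]_x (f x * normal_pdf a s x)%:E)%E.
  apply: eq_measure_integral => A mA _; exact/esym/lebesgue_shift.
rewrite (integral_pushforward mphi mg) ?preimage_setT ?E//.
Qed.

End gauss1.

Section integrable_EFin.
Context {dT : measure_display} {T : measurableType dT} {R : realType}.
Variables (mu : {measure set T -> \bar R}) (D : set T).
Hypothesis mD : measurable D.

Lemma integrable_EFinZ (k : R) (f : T -> R) : mu.-integrable D (EFin \o f) ->
  mu.-integrable D (EFin \o (fun x => k * f x)).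
Proof.
move=> /(integrableZl mD k); rewrite (_ : (fun _ => _) = EFin \o (fun x => k * f x))//.
Qed.

Lemma integrable_EFinD (f g : T -> R) : mu.-integrable D (EFin \o f) ->
  mu.-integrable D (EFin \o g) -> mu.-integrable D (EFin \o (fun x => f x + g x)).
Proof. exact: integrableD. Qed.

End integrable_EFin.

Section gauss1_shift.
Context {R : realType}.
Implicit Types (a s : R) (f G : R -> R).
Local Notation leb := (@lebesgue_measure R).

(* With [p] the density of N(a, s^2) with respect to N(0, s^2), the [eps]-power of [p] times the
   density of N(a, s^2) is a multiple of the density of N(a * (1 + eps), s^2). *)
Lemma normal_pdf_tilt a s (eps x : R) : s != 0 ->
  expR (eps * ((2 * a * x - a ^+ 2) / (2 * s ^+ 2))) * normal_pdf a s x =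
  expR (eps * (1 + eps) * (a ^+ 2 / (2 * s ^+ 2))) *
    normal_pdf (a * (1 + eps)) s x.
Proof.
move=> s0; rewrite !normal_pdfE// [LHS]mulrCA [RHS]mulrCA; congr (_ * _).
rewrite /normal_fun -!expRD; congr (expR _); rewrite !mulr2n; field.
by rewrite s0 -mulr2n -mulr_natl mulf_neq0 ?expf_neq0 ?pnatr_eq0.
Qed.

Lemma normal_pdf_density a s x : s != 0 ->
  normal_pdf a s x = expR ((2 * a * x - a ^+ 2) / (2 * s ^+ 2)) * normal_pdf 0 s x.
Proof.
move=> s0; rewrite !normal_pdfE// [RHS]mulrCA; congr (_ * _).
rewrite /normal_fun -!expRD; congr (expR _); rewrite !mulr2n; field.
by rewrite s0 -mulr2n -mulr_natl mulf_neq0 ?expf_neq0 ?pnatr_eq0.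
Qed.

(** Pointwise form of the entropy inequality, with [expR u] the density of the shifted Gaussian:
    take the tangent of [ln] at [I * expR u], then bound the unbounded term [u] by
    [(expR (eps * u) - 1) / eps]. The mean of the latter has a closed form by [normal_pdf_tilt]. *)
Lemma ln_expR_ineq (g I eps u : R) : 0 < g -> 0 < I -> 0 < eps ->
  expR u * ln g <= (ln I - 1 - eps^-1) * expR u +
    (I^-1 * g + eps^-1 * (expR (eps * u) * expR u)).
Proof.
move=> g0 I0 e0; have eu := expR_gt0 u.
have h1 := ln_le_div (mulr_gt0 I0 eu) g0.
rewrite lnM ?posrE// expRK in h1.
have h2 : eps * u <= expR (eps * u) - 1 by have := expR_ge1Dx (eps * u); lra.
have {}h2 : u <= (expR (eps * u) - 1) / eps by rewrite ler_pdivlMr// mulrC.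
have h3 : ln g <= ln I - 1 - eps^-1 + expR (eps * u) / eps + g / (I * expR u).
  apply: (le_trans h1); rewrite mulrBl mul1r in h2; lra.
have := ler_wpM2l (ltW eu) h3; set l := ln I; set v := expR (eps * u); set w := expR u in eu *.
have -> : w * (l - 1 - eps^-1 + v / eps + g / (I * w)) =
  (l - 1 - eps^-1) * w + (I^-1 * g + eps^-1 * (v * w)) by field; rewrite !gt_eqF.
by [].
Qed.

Lemma normal_pdf_ineq a s (eps g I x : R) : s != 0 -> 0 < g -> 0 < I -> 0 < eps ->
  ln g * normal_pdf a s x <= (ln I - 1 - eps^-1) * normal_pdf a s x +
    (I^-1 * (g * normal_pdf 0 s x) +
     expR (eps * (1 + eps) * (a ^+ 2 / (2 * s ^+ 2))) / eps * normal_pdf (a * (1 + eps)) s x).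
Proof.
move=> s0 g0 I0 e0.
have t := normal_pdf_tilt a eps x s0; rewrite (normal_pdf_density a x s0) in t *.
have := normal_pdf_ge0 0 s x; move: t.
set u := (_ - _) / _.
have := ln_expR_ineq u g0 I0 e0; set K := expR (_ * _ * _).
move: K (normal_pdf 0 s x) (normal_pdf (a * _) s x) => K p q.
set l := ln g; set l' := ln I; set w := expR u; set v := expR (eps * u).
move: w v l l' => w v l l' h t p0.
have -> : K / eps * q = eps^-1 * (v * (w * p)) by rewrite t mulrA [eps^-1 * K]mulrC.
have -> : l * (w * p) = w * l * p by ring.
apply: (le_trans (ler_wpM2r p0 h)).
by rewrite le_eqVlt; apply/orP; left; apply/eqP; ring.
Qed.

Lemma Rintegral_normal_pdf a s : \int[leb]_x normal_pdf a s x = 1.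
Proof. by rewrite /Rintegral integral_normal_pdf. Qed.

(** The first term is the Tsallis divergence of order [1 + eps] of N(a, s^2) from N(0, s^2); it
    tends to their relative entropy as [eps] tends to 0. *)
Lemma gauss_shift_eps a s G (c eps : R) : s != 0 -> 0 < c -> (forall x, c <= G x) ->
  bmeas G -> 0 < eps ->
  \int[normal_prob 0 s]_x ln (G (x + a)) <=
  (expR (eps * (1 + eps) * (a ^+ 2 / (2 * s ^+ 2))) - 1) / eps
  + ln (\int[normal_prob 0 s]_x G x).
Proof.
move=> s0 c0 cG bG eps0; have blG := bmeas_ln c0 cG bG.
rewrite (mean_normal_shift a s0 blG) (mean_normal _ _ blG).
set I := \int[normal_prob 0 s]_x G x; set K := expR _.
have I0 : 0 < I.
  apply: (lt_le_trans c0); rewrite -(mean_cst (normal_prob 0 s) c).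
  by apply: le_mean => //; exact: bmeas_cst.
have IE : \int[leb]_x (G x * normal_pdf 0 s x) = I by rewrite -mean_normal.
pose r x : R := (ln I - 1 - eps^-1) * normal_pdf a s x
   + (I^-1 * (G x * normal_pdf 0 s x) + (K / eps) * normal_pdf (a * (1 + eps)) s x).
have ipdf b := @integrable_normal_pdf R b s.
have ipdfZ b k : leb.-integrable setT (EFin \o (fun x => k * normal_pdf b s x)).
  exact: (integrable_EFinZ measurableT k (ipdf b)).
have iG := integrable_normal_pdfM 0 s bG.
have iGZ : leb.-integrable setT (EFin \o (fun x => I^-1 * (G x * normal_pdf 0 s x))).
  exact: (integrable_EFinZ measurableT _ iG).
have i2 : leb.-integrable setT (EFin \o
  (fun x => I^-1 * (G x * normal_pdf 0 s x) + (K / eps) * normal_pdf (a * (1 + eps)) s x)).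
  exact: (integrable_EFinD measurableT iGZ (ipdfZ _ _)).
have ir : leb.-integrable setT (EFin \o r).
  exact: (integrable_EFinD measurableT (ipdfZ _ _) i2).
apply: (@le_trans _ _ (\int[leb]_x r x)).
  apply: le_Rintegral => //; first exact: integrable_normal_pdfM.
  move=> x _; apply: normal_pdf_ineq => //; exact: lt_le_trans (cG x).
have Ek b k : \int[leb]_x (k * normal_pdf b s x) = k.
  by rewrite (RintegralZl k measurableT (ipdf b)) Rintegral_normal_pdf mulr1.
rewrite /r (RintegralD measurableT (ipdfZ _ _) i2) (RintegralD measurableT iGZ (ipdfZ _ _)).
rewrite !Ek (RintegralZl _ measurableT iG) IE mulVf ?gt_eqF//; set l := ln I.
have -> : l - 1 - eps^-1 + (1 + K / eps) = (K - 1) / eps + l by field; rewrite gt_eqF.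
by [].
Qed.

Lemma gauss_shift a s G (c : R) : s != 0 -> 0 < c -> (forall x, c <= G x) ->
  bmeas G ->
  \int[normal_prob 0 s]_x ln (G (x + a)) <=
  a ^+ 2 / (2 * s ^+ 2) + ln (\int[normal_prob 0 s]_x G x).
Proof.
move=> s0 c0 cG bG; set k := a ^+ 2 / _; set l := ln _.
have k0 : 0 <= k by rewrite divr_ge0 ?sqr_ge0// mulr_ge0 ?sqr_ge0.
rewrite -lerBlDr; set A := _ - l.
have H (eps : R) : 0 < eps -> A <= k * ((1 + eps) * expR (k * (eps * (1 + eps)))).
  move=> e0; rewrite /A lerBlDr; apply: (le_trans (gauss_shift_eps a s0 c0 cG bG e0)).
  rewrite lerD2r -/k; set u := eps * (1 + eps) * k.
  have u0 : 0 <= u by rewrite /u mulr_ge0// mulr_ge0 ?addr_ge0// ltW.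
  (* This removes the division by [eps]: what remains is continuous at [eps = 0], where its value is
     [k]. *)
  have h : expR u - 1 <= u * expR u.
    have := expR_ge1Dx (- u); rewrite expRN => h.
    have := ler_wpM2r (ltW (expR_gt0 u)) h; rewrite mulVf ?gt_eqF ?expR_gt0//; lra.
  rewrite ler_pdivrMr//; apply: (le_trans h).
  have -> : k * (eps * (1 + eps)) = u by rewrite mulrC.
  by have -> : k * ((1 + eps) * expR u) * eps = u * expR u by rewrite /u; ring.
have lim : (fun e : R => k * ((1 + e) * expR (k * (e * (1 + e))))) x @[x --> 0^'+] --> k.
  rewrite [X in _ --> X](_ : k = k * ((1 + 0) * expR (k * (0 * (1 + 0))))); last first.
    by rewrite mul0r mulr0 expR0; ring.
  apply: cvg_at_right_filter; apply: cvgM; first exact: cvg_cst.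
  apply: cvgM.
    by apply: cvgD; [exact: cvg_cst|exact: cvg_id].
  apply: (cvg_comp _ expR); last exact: continuous_expR.
  apply: cvgM; first exact: cvg_cst.
  apply: cvgM; first exact: cvg_id.
  by apply: cvgD; [exact: cvg_cst|exact: cvg_id].
apply: (cvgr_to_ge lim); near=> e; apply: H.
near: e; exact: nbhs_right_gt.
Unshelve. all: by end_near. Qed.

End gauss1_shift.

Section gauss_rV.
Context {R : realType}.
Implicit Types (s : R).

(* [normal_prob] lives on [measurableTypeR R], which carries the same sets as [R] but another
   display, so that [rV_cons] has to be declared measurable from there too. *)
Definition rV_consR n : measurableTypeR R * 'rV[R]_n -> 'rV[R]_n.+1 := @rV_cons R n.

Lemma measurable_rV_consR n : measurable_fun setT (@rV_consR n).
Proof. exact: (@measurable_funPT _ _ _ _ (@rV_cons R n)). Qed.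

HB.instance Definition _ n := isMeasurableFun.Build _ _
  (measurableTypeR R * 'rV[R]_n)%type 'rV[R]_n.+1 (@rV_consR n) (@measurable_rV_consR n).

Fixpoint gauss_rV (n : nat) s : probability 'rV[R]_n R :=
  match n with
  | 0 => @dirac _ 'rV[R]_0 0 R
  | k.+1 => distribution (normal_prob 0 s \x gauss_rV k s)%E (@rV_consR k)
  end.

Lemma gauss_rV_box n s (A : 'I_n -> set R) : (forall i, measurable (A i)) ->
  gauss_rV n s [set v | forall i, A i (v 0 i)] =
  (\prod_(i < n) normal_prob 0 s (A i))%E.
Proof.
elim: n A => [|n IH] A mA /=.
  by rewrite big_ord0 diracE mem_set// => -[].
rewrite big_ord_recl -IH// -product_measure1E//; last first.
  rewrite [X in measurable X](_ : _ = \bigcap_(i in [set: 'I_n])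
      ((fun v : 'rV[R]_n => v 0 i) @^-1` A (lift 0 i))).
    apply: fin_bigcap_measurable => // i _.
    by rewrite -[X in measurable X]setTI; exact: measurable_coord_rV.
  by apply/seteqP; split=> [v Av i _|v Av i]; [exact: Av|exact: (Av i)].
  exact: (mA ord0).
rewrite /distribution /pushforward; congr (_ _); apply/seteqP; split=> [[x v] /= Av|].
  by split => [|i]; [have := Av 0|have := Av (lift 0 i)];
    rewrite ?rV_cons0 ?rV_consS.
case=> x v [/= Ax Av] i; have [j ->|->] := unliftP 0 i.
  by rewrite rV_consS; exact: Av.
by rewrite rV_cons0.
Qed.

Definition rV_tail n (v : 'rV[R]_n.+1) : 'rV[R]_n := \row_i v 0 (lift 0 i).

Lemma rV_consD n x (y : 'rV[R]_n) (v : 'rV[R]_n.+1) :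
  rV_cons (x, y) + v = rV_cons (x + v 0 0, y + rV_tail v).
Proof.
apply/rowP => i; rewrite mxE; have [j ->|->] := unliftP 0 i.
  by rewrite !rV_consS !mxE.
by rewrite !rV_cons0.
Qed.

Lemma mean_gauss_rVS n s (f : 'rV[R]_n.+1 -> R) : bmeas f ->
  \int[gauss_rV n.+1 s]_x f x =
  \int[normal_prob 0 s]_x \int[gauss_rV n s]_y f (rV_cons (x, y)).
Proof.
move=> bf; have mc := @measurable_rV_consR n.
rewrite -(mean_prod _ _ (bmeas_comp bf mc)); apply/esym.
exact: (mean_law mc).
Qed.

Lemma measurable_rV_addl n (v : 'rV[R]_n) : measurable_fun setT (fun x : 'rV[R]_n => x + v).
Proof.
apply: measurable_fun_rV => i; under eq_fun do rewrite mxE.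
by apply: measurable_funD => //; exact: measurable_coord_rV.
Qed.

(* Condition on the first coordinate and apply the one-dimensional inequality to the rest. *)
Lemma gauss_rV_shift n s (v : 'rV[R]_n) (G : 'rV[R]_n -> R) (c : R) : s != 0 ->
  0 < c -> (forall x, c <= G x) -> bmeas G ->
  \int[gauss_rV n s]_x ln (G (x + v)) <=
  enorm v ^+ 2 / (2 * s ^+ 2) + ln (\int[gauss_rV n s]_x G x).
Proof.
move=> s0 c0; rewrite /enorm sqr_sqrtr ?sumr_ge0// => [|i _]; last exact: sqr_ge0.
elim: n v G => [|n IH] v G cG bG.
  rewrite big_ord0 mul0r add0r.
  have -> : (fun x : 'rV[R]_0 => ln (G (x + v))) = (fun x => ln (G x)).
    by apply/funext => x; rewrite (_ : v = 0) ?addr0//; apply/rowP => -[].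
  exact: (mean_ln_le (gauss_rV 0 s) c0 cG bG).
have bGv := bmeas_comp bG (measurable_rV_addl v).
have cGv x : c <= (G \o (fun x => x + v)) x by exact: cG.
have mc := @measurable_rV_consR n.
rewrite mean_gauss_rVS//; last exact: (bmeas_ln c0 cGv).
rewrite mean_gauss_rVS// big_ord_recl mulrDl.
pose G1 x := \int[gauss_rV n s]_y G (rV_cons (x, y)).
have bGc := bmeas_comp bG mc.
have bG1 : bmeas G1 by exact: (bmeas_fubini (normal_prob 0 s) (gauss_rV n s) bGc).
have bsl x : bmeas (fun y => G (rV_cons (x, y))) by exact: (bmeas_slice bGc).
have cG1 x : c <= G1 x.
  by rewrite -(mean_cst (gauss_rV n s) c); apply: le_mean => //; exact: bmeas_cst.
rewrite -/G1 addrAC; set B := (\sum_(i < n) _) / _.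
have h x : \int[gauss_rV n s]_y ln (G (rV_cons (x, y) + v)) <= B + ln (G1 (x + v 0 0)).
  under eq_Rintegral do rewrite rV_consD.
  apply: (le_trans (IH (rV_tail v) (fun y => G (rV_cons (x + v 0 0, y))) _ _)) => //.
  by rewrite lerD2r /B; under eq_bigr do rewrite mxE.
apply: (@le_trans _ _ (\int[normal_prob 0 s]_x (B + ln (G1 (x + v 0 0))))).
  apply: le_mean => //.
    exact: (bmeas_fubini (normal_prob 0 s) (gauss_rV n s) (bmeas_comp (bmeas_ln c0 cGv bGv) mc)).
  apply: bmeasD; first exact: bmeas_cst.
  exact: (bmeas_comp (bmeas_ln c0 cG1 bG1) (measurable_addl (v 0 0))).
rewrite meanD; [|exact: bmeas_cst|]; last first.
  exact: (bmeas_comp (bmeas_ln c0 cG1 bG1) (measurable_addl (v 0 0))).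
rewrite mean_cst [leLHS]addrC lerD2r; exact: (gauss_shift _ _ c0).
Qed.

Definition rV_boxes n : set (set 'rV[R]_n) :=
  [set [set v : 'rV[R]_n | forall i, A i (v 0 i)] |
    A in [set A : 'I_n -> set R | forall i, measurable (A i)]].

Lemma measurable_rV_box n (A : 'I_n -> set R) : (forall i, measurable (A i)) ->
  measurable [set v : 'rV[R]_n | forall i, A i (v 0 i)].
Proof.
move=> mA; rewrite [X in measurable X](_ : _ = \bigcap_(i in [set: 'I_n])
    ((fun v : 'rV[R]_n => v 0 i) @^-1` A i)).
  apply: fin_bigcap_measurable => // i _.
  by rewrite -[X in measurable X]setTI; exact: measurable_coord_rV.
by apply/seteqP; split=> [v Av i _|v Av i]; [exact: Av|exact: (Av i)].
Qed.

(** For the inclusion of Borel sets, the identity is viewed as a map from the space that carries the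
    sigma-algebra of boxes: its coordinates are measurable, hence so is the map. *)
Lemma measurable_rV_boxes n : @measurable _ 'rV[R]_n = <<s @rV_boxes n >>.
Proof.
apply/seteqP; split; last first.
  apply: smallest_sub; first exact: sigma_algebra_measurable.
  by move=> _ [A mA <-]; exact: measurable_rV_box.
pose G := g_sigma_algebraType (@rV_boxes n).
have mid : measurable_fun setT (id : G -> 'rV[R]_n).
  apply: measurable_fun_rV => i _ B mB; rewrite setTI; apply: sub_sigma_algebra.
  exists (fun j => if j == i then B else setT).
    by move=> j /=; case: ifP.
  apply/seteqP; split => v /= Bv; first by have := Bv i; rewrite eqxx.
  by move=> j; case: eqP => // ->.
move=> A mA; have := mid measurableT A mA; rewrite setTI.
by rewrite preimage_id.
Qed.

(** [bm_normal] prescribes the law of a Brownian increment on boxes only. They are stable under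
    intersection and generate the Borel sets, so they determine the law. *)
Lemma gauss_rV_unique n s (m : {measure set 'rV[R]_n -> \bar R}) :
  (forall A : 'I_n -> set R, (forall i, measurable (A i)) ->
   m [set v | forall i, A i (v 0 i)] = (\prod_(i < n) normal_prob 0 s (A i))%E) ->
  forall A, measurable A -> m A = gauss_rV n s A.
Proof.
move=> mE; apply: (@measure_unique _ _ _ (@rV_boxes n) (fun=> setT)).
- exact: measurable_rV_boxes.
- move=> _ _ [A mA <-] [B mB <-]; exists (fun i => A i `&` B i).
    by move=> i; exact: measurableI.
  by apply/seteqP; split => v /= h; [split => i; have [] := h i|move=> i; split; apply h].
- move=> _; exists (fun=> setT) => //.
  by apply/seteqP; split.
- by rewrite bigcup_const//; exists 0%N.
- by move=> _ [A mA <-]; rewrite (mE _ mA); exact/esym/gauss_rV_box.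
move=> _; have -> : [set: 'rV[R]_n] = [set v | forall i : 'I_n, [set: R] (v 0 i)].
  by apply/seteqP; split.
rewrite (mE (fun=> setT) (fun=> measurableT)).
by rewrite big1 ?ltry// => i _; exact: probability_setT.
Qed.

End gauss_rV.

(** * Euclidean inner product and norm *)

Section euclid.
Context {R : realType} {d : nat}.
Implicit Types (x y z : 'rV[R]_d) (a : R).

Definition dotr x y : R := \sum_(i < d) x 0 i * y 0 i.

Lemma dotrC x y : dotr x y = dotr y x.
Proof. by apply: eq_bigr => i _; rewrite mulrC. Qed.

Lemma dotrDl x y z : dotr (x + y) z = dotr x z + dotr y z.
Proof. by rewrite -big_split; apply: eq_bigr => i _; rewrite !mxE mulrDl. Qed.

Lemma dotrDr x y z : dotr x (y + z) = dotr x y + dotr x z.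
Proof. by rewrite dotrC dotrDl !(dotrC x). Qed.

Lemma dotrZl a x y : dotr (a *: x) y = a * dotr x y.
Proof. by rewrite mulr_sumr; apply: eq_bigr => i _; rewrite !mxE mulrA. Qed.

Lemma dotrZr a x y : dotr x (a *: y) = a * dotr x y.
Proof. by rewrite dotrC dotrZl dotrC. Qed.

Lemma dotrNl x y : dotr (- x) y = - dotr x y.
Proof. by rewrite -scaleN1r dotrZl mulN1r. Qed.

Lemma dotrNr x y : dotr x (- y) = - dotr x y.
Proof. by rewrite dotrC dotrNl dotrC. Qed.

Lemma enorm_ge0 x : 0 <= enorm x.
Proof. exact: sqrtr_ge0. Qed.

Lemma enorm_sqr x : enorm x ^+ 2 = dotr x x.
Proof.
rewrite /enorm sqr_sqrtr; first by apply: eq_bigr => i _; rewrite expr2.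
by rewrite sumr_ge0// => i _; exact: sqr_ge0.
Qed.

Lemma enormZ a x : enorm (a *: x) = `|a| * enorm x.
Proof.
apply: (@pexpIrn _ 2); rewrite ?nnegrE ?mulr_ge0 ?enorm_ge0//.
by rewrite exprMn !enorm_sqr dotrZl dotrZr -normrX ger0_norm ?sqr_ge0// mulrA.
Qed.

(** With [a], [b] the norms and [c] the inner product, the squared norm of [b *: x - a *: y] is
    [2 * a * b * (a * b - c)]. Division by [a * b] requires the case of a zero vector apart. *)
Lemma dotr_enorm x y : dotr x y <= enorm x * enorm y.
Proof.
have [|] := boolP (enorm x * enorm y == 0).
  rewrite mulf_eq0 => /orP[]/eqP e0; have := enorm_sqr x; have := enorm_sqr y;
    rewrite e0 ?(mulr0, mul0r) expr0n /= => hy hx.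
    rewrite /dotr big1// => i _; have /eqP := esym hx.
    rewrite psumr_eq0; last by move=> j _; rewrite -expr2 sqr_ge0.
    by move=> /allP/(_ i (mem_index_enum _)) /=; rewrite mulf_eq0 orbb => /eqP ->; rewrite mul0r.
  rewrite /dotr big1// => i _; have /eqP := esym hy.
  rewrite psumr_eq0; last by move=> j _; rewrite -expr2 sqr_ge0.
  by move=> /allP/(_ i (mem_index_enum _)) /=; rewrite mulf_eq0 orbb => /eqP ->; rewrite mulr0.
move=> e0; have p0 : 0 < enorm x * enorm y by rewrite lt_neqAle eq_sym e0 mulr_ge0 ?enorm_ge0.
have := sqr_ge0 (enorm (enorm y *: x - enorm x *: y)).
rewrite enorm_sqr dotrDl !dotrDr dotrNl !dotrNr !dotrZl !dotrZr dotrNl !dotrZl.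
rewrite -!enorm_sqr (dotrC y x).
set a := enorm x in p0 *; set b := enorm y in p0 *; set c := dotr x y => h.
have : a * b * c <= (a * b) * (a * b) by nra.
by rewrite ler_pM2l.
Qed.

Lemma enorm_triangle x y : enorm (x + y) <= enorm x + enorm y.
Proof.
rewrite -(@ler_pXn2r _ 2) ?nnegrE ?addr_ge0 ?enorm_ge0//.
rewrite enorm_sqr dotrDl !dotrDr -!enorm_sqr (dotrC y x).
have := dotr_enorm x y; rewrite sqrrD; lra.
Qed.

Lemma enormN x : enorm (- x) = enorm x.
Proof. by rewrite -scaleN1r enormZ normrN1 mul1r. Qed.

End euclid.

(** * Log-Harnack inequality for Euler chains *)

Section geometric_sums.
Context {R : realType}.
Variable rho : R.
Hypothesis rho01 : 0 < rho <= 1.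

Definition gsum N : R := \sum_(k < N) rho ^+ k.
Definition gsum2 N : R := \sum_(k < N) (rho ^+ k) ^+ 2.

Lemma gsumS N : gsum N.+1 = gsum N + rho ^+ N.
Proof. by rewrite /gsum big_ord_recr. Qed.

Lemma gsum2S N : gsum2 N.+1 = gsum2 N + (rho ^+ N) ^+ 2.
Proof. by rewrite /gsum2 big_ord_recr. Qed.

Lemma gsum_gt0 N : 0 < gsum N.+1.
Proof.
have /andP[r0 _] := rho01; rewrite gsumS ltr_wpDl ?exprn_gt0//.
by rewrite sumr_ge0// => i _; rewrite exprn_ge0// ltW.
Qed.

Lemma gsum2_gt0 N : 0 < gsum2 N.+1.
Proof.
have /andP[r0 _] := rho01; rewrite gsum2S ltr_wpDl ?exprn_gt0//.
by rewrite sumr_ge0// => i _; rewrite sqr_ge0.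
Qed.

(** This is the hypothesis [p * S <= Q] of [optimal_shift]. *)
Lemma gsum_gsum2 N : rho ^+ N * gsum N <= gsum2 N.
Proof.
have /andP[r0 r1] := rho01; rewrite mulr_sumr; apply: ler_sum => i _.
rewrite expr2 ler_wpM2r ?exprn_ge0 ?(ltW r0)//.
by apply: (ler_wiXn2l (ltW r0) r1); exact: ltnW.
Qed.

(** If the gap evolves by [r_j = rho r_(j-1) + delta - a_j], it vanishes at step N exactly when the
    sum of the [rho^(N-j) a_j] is [rho^N r + delta * gsum N]. By Cauchy-Schwarz the formula is then
    the least value of the sum of the [a_j^2 / (4 h)]. *)
Definition harnack_cost (h delta : R) N (r : R) : R :=
  (rho ^+ N * r + delta * gsum N) ^+ 2 / (4 * h * gsum2 N).

(* The optimal shift is [a = A p / (Q + p^2)] with [A = p s + delta S], the minimizer of the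
   left-hand side; it exceeds [s] only when [s] is small, and then [a = s] is good enough. *)
Lemma optimal_shift (p S Q delta s s' : R) : 0 < p -> 0 < S -> 0 < Q -> p * S <= Q ->
  0 <= delta -> 0 <= s -> s <= s' -> delta <= s' ->
  exists2 a, 0 <= a <= s &
    (p * (s - a) + delta * S) ^+ 2 / Q + a ^+ 2 <=
    (p * s' + delta * S) ^+ 2 / (Q + p ^+ 2).
Proof.
move=> p0 S0 Q0 pSQ d0 s0 ss' ds'.
have QP : 0 < Q + p ^+ 2 by rewrite addr_gt0 ?exprn_gt0.
have p0' := ltW p0; have S0' := ltW S0; have Q0' := ltW Q0; have QP' := ltW QP.
set A := p * s + delta * S.
have A0 : 0 <= A by rewrite addr_ge0 ?mulr_ge0.
have AA' : A <= p * s' + delta * S by rewrite lerD2r ler_wpM2l.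
have [As|As] := leP (A * p / (Q + p ^+ 2)) s.
  exists (A * p / (Q + p ^+ 2)).
    by rewrite As divr_ge0 ?mulr_ge0.
  have -> : (p * (s - A * p / (Q + p ^+ 2)) + delta * S) ^+ 2 / Q +
      (A * p / (Q + p ^+ 2)) ^+ 2 = A ^+ 2 / (Q + p ^+ 2).
    have -> : p * (s - A * p / (Q + p ^+ 2)) + delta * S = A * Q / (Q + p ^+ 2).
      by rewrite /A; field; rewrite gt_eqF.
    by field; rewrite !gt_eqF.
  by rewrite ler_pM2r ?invr_gt0// ler_pXn2r ?nnegrE// (le_trans A0).
(* The whole gap is closed at once, and only [delta] is left to pay for in the later steps. *)
exists s; first by rewrite s0 lexx.
rewrite subrr mulr0 add0r.
have sQ : s * Q <= delta * S * p.
  by move: As; rewrite ltr_pdivlMr// /A => /ltW; nra.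
have {}sQ : s <= delta * S * p / Q by rewrite ler_pdivlMr.
apply: (@le_trans _ _ ((delta * S) ^+ 2 / Q + (delta * S * p / Q) ^+ 2)).
  by rewrite lerD2l ler_pXn2r ?nnegrE// (le_trans s0).
apply: (@le_trans _ _ ((p * delta + delta * S) ^+ 2 / (Q + p ^+ 2))); last first.
  rewrite ler_pM2r ?invr_gt0// ler_pXn2r ?nnegrE ?addr_ge0 ?mulr_ge0//.
    by rewrite lerD2r ler_wpM2l.
  exact: le_trans ds'.
have -> : (delta * S) ^+ 2 / Q + (delta * S * p / Q) ^+ 2 =
  (delta * (S * (Q + p ^+ 2) / Q)) ^+ 2 / (Q + p ^+ 2) by field; rewrite !gt_eqF.
rewrite ler_pM2r ?invr_gt0// ler_pXn2r ?nnegrE ?addr_ge0 ?mulr_ge0 ?invr_ge0//.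
have -> : p * delta + delta * S = delta * (p + S) by ring.
(* What remains, [S * (Q + p ^+ 2) <= (p + S) * Q], is [p * S <= Q] multiplied by [p]. *)
rewrite ler_wpM2l// ler_pdivrMr//.
have := ler_wpM2l (ltW p0) pSQ; nra.
Qed.

End geometric_sums.

Section euler_kernel.
Context {R : realType} {d : nat}.
Implicit Types (x y z v : 'rV[R]_d) (phi G : 'rV[R]_d -> R).
Variables (F : 'rV[R]_d -> 'rV[R]_d) (h : R).
Hypotheses (mF : measurable_fun setT F) (h0 : 0 < h).

Lemma measurable_rV_affine {dT} {T : measurableType dT} (f g : T -> 'rV[R]_d) (a : R) :
  measurable_fun setT f -> measurable_fun setT g ->
  measurable_fun setT (fun w => f w + a *: g w).
Proof.
move=> mf mg; apply: measurable_fun_rV => i; under eq_fun do rewrite !mxE.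
apply: measurable_funD; first exact: (measurableT_comp (@measurable_coord_rV R d i) mf).
apply: measurable_funM => //; exact: (measurableT_comp (@measurable_coord_rV R d i) mg).
Qed.

Lemma measurable_rV_cst_affine (u : 'rV[R]_d) (a : R) :
  measurable_fun setT (fun z : 'rV[R]_d => u + a *: z).
Proof. by apply: measurable_rV_affine; [exact: measurable_cst|exact: measurable_id]. Qed.

(** The factor [Num.sqrt 2] stays outside the Gaussian, whose law is then that of a Brownian
    increment over a time [h] ([increment_law]). *)
Definition euler_op phi x : R :=
  \int[gauss_rV d (Num.sqrt h)]_z phi (F x + Num.sqrt 2 *: z).

Lemma measurable_euler_step :
  measurable_fun setT (fun p : 'rV[R]_d * 'rV[R]_d => F p.1 + Num.sqrt 2 *: p.2).
Proof.
apply: measurable_rV_affine; last exact: measurable_snd.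
exact: (measurableT_comp mF measurable_fst).
Qed.

Lemma bmeas_euler_op phi : bmeas phi -> bmeas (euler_op phi).
Proof.
move=> bphi; set P := gauss_rV d (Num.sqrt h).
exact: (bmeas_fubini P P (bmeas_comp bphi measurable_euler_step)).
Qed.

Lemma bmeas_euler_slice phi x : bmeas phi -> bmeas (fun z => phi (F x + Num.sqrt 2 *: z)).
Proof. by move=> bphi; exact: (bmeas_slice (bmeas_comp bphi measurable_euler_step)). Qed.

Lemma bmeas_iter_euler_op N phi : bmeas phi -> bmeas (iter N euler_op phi).
Proof. by move=> bphi; elim: N => //= N; exact: bmeas_euler_op. Qed.

Lemma iter_euler_op_ge N phi (c : R) : bmeas phi -> (forall x, c <= phi x) ->
  forall x, c <= iter N euler_op phi x.
Proof.
move=> bphi cphi; elim: N => //= N IH x.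
rewrite -(mean_cst (gauss_rV d (Num.sqrt h)) c); apply: le_mean => //.
  exact: bmeas_cst.
by apply: bmeas_euler_slice; exact: bmeas_iter_euler_op.
Qed.

Variables (rho delta : R).
Hypotheses (rho01 : 0 < rho <= 1) (delta0 : 0 <= delta).
Hypothesis F_contr : forall x y, enorm (F x - F y) <= rho * enorm (x - y) + delta.

(** Displacing the state by [v] amounts to shifting the noise by [v] divided by [Num.sqrt 2]. As the
    noise has variance [h], the cost is [enorm v ^+ 2 / (4 * h)]: this is the origin of the 4 in the
    bound for [alpha = 0]. *)
Lemma euler_op_shift G (c : R) x v : 0 < c -> (forall y, c <= G y) -> bmeas G ->
  \int[gauss_rV d (Num.sqrt h)]_z ln (G (F x + v + Num.sqrt 2 *: z)) <=
  enorm v ^+ 2 / (4 * h) + ln (euler_op G x).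
Proof.
move=> c0 cG bG; have sq2 : 0 < Num.sqrt 2 :> R by rewrite sqrtr_gt0.
have s0 : Num.sqrt h != 0 by rewrite gt_eqF// sqrtr_gt0.
have := gauss_rV_shift ((Num.sqrt 2)^-1 *: v) s0 c0 (fun z => cG (F x + Num.sqrt 2 *: z))
  (bmeas_euler_slice x bG).
rewrite enormZ exprMn -normrX ger0_norm ?sqr_ge0// exprVn (sqr_sqrtr (ltW h0)) (sqr_sqrtr (ler0n R 2)).
rewrite -/(euler_op G x) -[(_ * _) / (2 * h)]mulrA mulrC -mulrA -invfM.
have -> : 2 * h * 2 = 4 * h :> R by ring.
suff -> : (fun z => ln (G (F x + Num.sqrt 2 *: (z + (Num.sqrt 2)^-1 *: v)))) =
  (fun z => ln (G (F x + v + Num.sqrt 2 *: z))) by [].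
apply/funext => z; rewrite scalerDr scalerA divff ?gt_eqF// scale1r.
by rewrite -addrA [v + _]addrC.
Qed.

(* The two chains are driven by the same noise, and at each step part of their gap is closed by
   shifting the noise of the second one; the shift is paid for by [euler_op_shift]. *)
Lemma euler_log_harnack N G (c : R) x y : 0 < c -> (forall y, c <= G y) -> bmeas G ->
  iter N.+1 euler_op (fun x => ln (G x)) x <=
  harnack_cost rho h delta N.+1 (enorm (x - y)) + ln (iter N.+1 euler_op G y).
Proof.
move=> c0 cG bG; have blG := bmeas_ln c0 cG bG.
have [r0 r1] := andP rho01.
elim: N x y => [|N IH] x y.
  (* With a single step left, the shift has to close the whole gap [F x - F y]. *)
  rewrite /= /harnack_cost /gsum /gsum2 !big_ord1 expr0 expr1n !mulr1 expr1.
  have := @euler_op_shift G c y (F x - F y) c0 cG bG; rewrite subrKC => /le_trans.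
  apply; rewrite lerD2r ler_pM2r ?invr_gt0 ?mulr_gt0//.
  by rewrite ler_pXn2r ?nnegrE ?addr_ge0 ?mulr_ge0 ?enorm_ge0// ltW.
have [|a /andP[a0 as_] Ha] := @optimal_shift _ (rho ^+ N.+1) (gsum rho N.+1)
  (gsum2 rho N.+1) delta (enorm (F x - F y)) (rho * enorm (x - y) + delta)
  (exprn_gt0 _ r0) (gsum_gt0 rho01 N) (gsum2_gt0 rho01 N) (gsum_gsum2 rho01 _)
  delta0 (enorm_ge0 _) (F_contr x y).
  by rewrite lerDr mulr_ge0 ?enorm_ge0// ltW.
set s := enorm (F x - F y) in as_ Ha.
(* [th] is the fraction of the gap that a shift of length [a] closes; the shift is taken along the
   gap itself. *)
have [th [th0 th1 ths]] : exists th : R, [/\ 0 <= th, th <= 1 & th * s = a].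
  have [s0|s0] := eqVneq s 0.
    exists 0; rewrite mul0r; split => //; apply/eqP.
    by rewrite eq_le a0 -s0 as_.
  have sp : 0 < s by rewrite lt_neqAle eq_sym s0 enorm_ge0.
  by exists (a / s); rewrite divfK// divr_ge0 ?enorm_ge0// ler_pdivrMr// mul1r.
pose D := F x - F y.
pose f := fun x => ln (G x).
change (euler_op (iter N.+1 euler_op f) x <= harnack_cost rho h delta N.+2 (enorm (x - y)) +
  ln (euler_op (iter N.+1 euler_op G) y)).
set g := iter N.+1 euler_op G.
have bg : bmeas g by exact: bmeas_iter_euler_op.
have cg z : c <= g z by exact: iter_euler_op_ge.
set e := enorm (x - y).
pose C := harnack_cost rho h delta N.+1 (s - a).
(* For each value [z] of the common noise, the remaining steps start from two points at distance
   [s - a]. *)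
have step z : iter N.+1 euler_op f (F x + Num.sqrt 2 *: z) <=
    C + ln (g (F y + th *: D + Num.sqrt 2 *: z)).
  apply: (le_trans (IH _ (F y + th *: D + Num.sqrt 2 *: z))).
  rewrite lerD2r opprD addrACA subrr addr0.
  have -> : F x - (F y + th *: D) = (1 - th) *: D.
    by rewrite opprD addrA scalerBl scale1r.
  by rewrite enormZ ger0_norm ?subr_ge0// -/s mulrBl mul1r ths.
apply: (@le_trans _ _ (\int[gauss_rV d (Num.sqrt h)]_z
    (C + ln (g (F y + th *: D + Num.sqrt 2 *: z))))).
  apply: le_mean => //.
    by apply: bmeas_euler_slice; exact: bmeas_iter_euler_op.
  apply: bmeasD; first exact: bmeas_cst.
  apply: (bmeas_comp (bmeas_ln c0 cg bg)).
  exact: measurable_rV_cst_affine.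
rewrite meanD; [|exact: bmeas_cst|]; last first.
  apply: (bmeas_comp (bmeas_ln c0 cg bg)).
  exact: measurable_rV_cst_affine.
rewrite mean_cst.
apply: (@le_trans _ _ (C + (enorm (th *: D) ^+ 2 / (4 * h) + ln (euler_op g y)))).
  by rewrite lerD2l; exact: (@euler_op_shift g c y (th *: D) c0 cg bg).
rewrite addrA lerD2r enormZ ger0_norm// ths /C /harnack_cost.
rewrite [gsum _ N.+2]gsumS [gsum2 _ N.+2]gsum2S.
have h40 : 0 < (4 * h)^-1 by rewrite invr_gt0 mulr_gt0.
have E (X Q : R) : X / (4 * h * Q) = (4 * h)^-1 * (X / Q) by rewrite invfM mulrCA.
rewrite !E [a ^+ 2 / _]mulrC -mulrDr ler_pM2l//; apply: (le_trans Ha).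
suff -> : rho ^+ N.+1 * (rho * enorm (x - y) + delta) + delta * gsum rho N.+1 =
  rho ^+ N.+2 * e + delta * (gsum rho N.+1 + rho ^+ N.+1) by [].
by rewrite [rho ^+ N.+2]exprSr -/e; ring.
Qed.

End euler_kernel.

(** * Contraction of the gradient step *)

Section real_ineq.
Context {R : realFieldType}.

Lemma le_add_cross (u w s t W : R) : u + s + W <= w -> w + t + W <= u ->
  2 * W <= - s - t.
Proof. by move=> h1 h2; lra. Qed.

Lemma le_sub2_half (u w p a b W : R) : a - b = 2 * W ->
  u + (p - b) <= w - a + W -> u + p + W <= w.
Proof. by move=> h1 h2; lra. Qed.

End real_ineq.

Lemma enorm_sub_sqr {R : realType} {d : nat} (x y : 'rV[R]_d) (h : R) :
  enorm (x - h *: y) ^+ 2 = enorm x ^+ 2 - 2 * h * dotr y x + h * h * enorm y ^+ 2.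
Proof.
rewrite !enorm_sqr dotrDl !dotrDr !dotrNl !dotrNr !dotrZl !dotrZr (dotrC x y); ring.
Qed.

Lemma continuous_is_derive {R : realType} (f df : R -> R) (a b : R) :
  (forall t : R, is_derive t 1 f (df t)) ->
  {within `[a, b], continuous f}.
Proof.
move=> h; apply: continuous_subspaceT => t.
apply: differentiable_continuous; apply/derivable1_diffP.
by have [] := h t.
Qed.

Lemma MVT01 {R : realType} (f df : R -> R) (b : R) : 0 < b -> (forall t : R, is_derive t 1 f (df t)) ->
  exists2 c, 0 < c < b & f b - f 0 = df c * b.
Proof.
move=> b0 h; have [|c cb ->] := @MVT R f df 0 b b0 (fun x _ => h x).
  exact: continuous_is_derive h.
by exists c; rewrite ?subr0//; move: cb; rewrite in_itv.
Qed.

Section line_calculus.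
Context {R : realType} {d : nat}.
Implicit Types (f V : 'rV[R]_d -> R) (x y v : 'rV[R]_d).

Lemma is_derive_line f x v (t : R) : differentiable f (x + t *: v) ->
  is_derive t 1 (fun t : R => f (x + t *: v)) (dotr (grad f (x + t *: v)) v).
Proof.
move=> df; set a := x + t *: v in df *.
have E : (fun h : R => h^-1 *: (((fun t : R => f (x + t *: v)) \o shift t) (h *: 1) -
    f (x + t *: v))) = (fun h : R => h^-1 *: ((f \o shift a) (h *: v) - f a)).
  apply/funext => h /=; congr (_ *: (f _ - _)).
  by rewrite /a scalerDl [h *: 1]mulr1 addrCA.
have dv : derivable f a v by exact: diff_derivable.
have -> : dotr (grad f a) v = 'D_v f a.
  rewrite (deriveE v df) {2}(row_sum_delta v) linear_sum/=.
  apply: eq_bigr => i _; rewrite linearZ/= -(deriveE _ df) mxE mulrC.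
  by [].
by split; rewrite ?/derivable ?/derive E.
Qed.

Lemma is_derive_grad_line f x v w (t : R) : differentiable (grad f) (x + t *: v) ->
  is_derive t 1 (fun t : R => dotr (grad f (x + t *: v)) w)
    ((v *m (hess f (x + t *: v))^T *m w^T) 0 0).
Proof.
move=> dg.
have dgi i : differentiable (fun y => grad f y 0 i) (x + t *: v).
  exact: (differentiable_comp dg (differentiable_coord _ 0 i)).
have -> : (fun t : R => dotr (grad f (x + t *: v)) w) =
    \sum_(i < d) (fun t : R => grad f (x + t *: v) 0 i * w 0 i).
  by apply/funext => s; rewrite fct_sumE.
have -> : (v *m (hess f (x + t *: v))^T *m w^T) 0 0 =
    \sum_(i < d) dotr (grad (fun y => grad f y 0 i) (x + t *: v)) v * w 0 i.
  rewrite mxE; apply: eq_bigr => i _; rewrite !mxE; congr (_ * _).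
  by apply: eq_bigr => j _; rewrite !mxE mulrC.
apply: is_derive_sum => i.
have := is_derive_line (dgi i) => h.
rewrite [X in is_derive _ _ X _](_ : _ = w 0 i \*: (fun t : R => grad f (x + t *: v) 0 i)).
  by rewrite mulrC; apply: is_deriveZ.
by apply/funext => s; rewrite mulrC.
Qed.

End line_calculus.

Section convexity.
Context {R : realType} {d : nat}.
Variables (V : 'rV[R]_d -> R) (alpha beta : R).
Hypotheses (VC2 : C2 V) (alpha_ge0 : 0 <= alpha) (beta_gt0 : 0 < beta).
Hypothesis hessV : forall x, loewner_le alpha%:M (hess V x) /\ loewner_le (hess V x) beta%:M.
Implicit Types (x y v : 'rV[R]_d).

Let quad_scalar (k : R) v : (v *m k%:M *m v^T) 0 0 = k * enorm v ^+ 2.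
Proof.
rewrite mul_mx_scalar -scalemxAl mxE enorm_sqr; congr (_ * _).
by rewrite mxE; apply: eq_bigr => i _; rewrite mxE.
Qed.

(** The derivative of the gradient along [v] brings in the transposed Hessian, and a quadratic form
    does not see the transposition. *)
Let quad_tr (A : 'M[R]_d) v : (v *m A^T *m v^T) 0 0 = (v *m A *m v^T) 0 0.
Proof.
have -> : v *m A^T *m v^T = (v *m A *m v^T)^T by rewrite !trmx_mul trmxK mulmxA.
by rewrite mxE.
Qed.

Lemma hess_quad x v :
  alpha * enorm v ^+ 2 <= (v *m (hess V x)^T *m v^T) 0 0 <= beta * enorm v ^+ 2.
Proof.
rewrite quad_tr -!quad_scalar; have [h1 h2] := hessV x.
have := h1 v; have := h2 v.
by rewrite !mulmxBr !mulmxBl !mxE !subr_ge0 => -> ->.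
Qed.

Lemma grad_mono x v (t : R) : 0 <= t ->
  alpha * enorm v ^+ 2 * t <= dotr (grad V (x + t *: v)) v - dotr (grad V x) v
    <= beta * enorm v ^+ 2 * t.
Proof.
have [_ dg _] := VC2.
rewrite le_eqVlt => /predU1P[<-|t0]; first by rewrite scale0r addr0 subrr !mulr0 lexx.
have [c _] := MVT01 t0 (fun s => is_derive_grad_line v (dg (x + s *: v))).
rewrite scale0r addr0 => ->; have /andP[h1 h2] := hess_quad (x + c *: v) v.
by rewrite !ler_pM2r// h1.
Qed.

Lemma convex_ineq x y : V x + dotr (grad V x) (y - x) <= V y.
Proof.
have [df _ _] := VC2; set v := y - x.
have [c /andP[c0 _]] := MVT01 ltr01 (fun s => is_derive_line (df (x + s *: v))).
rewrite scale0r addr0 scale1r mulr1 subrKC -lerBrDl => ->.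
have /andP[h _] := grad_mono x v (ltW c0).
rewrite -subr_ge0; apply: le_trans h.
by rewrite mulr_ge0 ?(ltW c0)// mulr_ge0 ?sqr_ge0.
Qed.

(** The mean value theorem is applied to [psi], the difference between [V] along the segment and its
    quadratic bound; [grad_mono] makes its derivative nonpositive. *)
Lemma descent_ineq x y : V y <= V x + dotr (grad V x) (y - x) + beta / 2 * enorm (y - x) ^+ 2.
Proof.
have [df _ _] := VC2; set v := y - x; set A := dotr (grad V x) v; set B := enorm v ^+ 2.
pose psi (t : R) := V (x + t *: v) - (A * t + beta / 2 * B * t ^+ 2).
have dpsi (t : R) : is_derive t 1 psi (dotr (grad V (x + t *: v)) v - (A + beta * B * t)).
  apply: is_deriveB; first exact: is_derive_line.
  apply: is_derive_eq.
  by change (A * 1 + beta / 2 * B * (t * 1 + t * 1) = A + beta * B * t); field.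
have [c /andP[c0 _]] := MVT01 ltr01 dpsi.
rewrite /psi scale0r addr0 scale1r subrKC mulr1 => E.
have /andP[_ h] := grad_mono x v (ltW c0).
move: E h; rewrite -/A -/B; set p := dotr _ _; set q := V y.
rewrite !(mulr0, expr0n, mulr1, expr1n)/= addr0 subr0; lra.
Qed.

(* Co-coercivity of the gradient, by comparing [V - <grad V x, .>], which is minimal at [x], with
   its value one gradient step away from [y]. *)
Lemma grad_half_cocoercive x y :
  V x + dotr (grad V x) (y - x) + (2 * beta)^-1 * enorm (grad V y - grad V x) ^+ 2 <= V y.
Proof.
set g := grad V y - grad V x; set z := y - beta^-1 *: g.
have h1 := convex_ineq x z; have h2 := descent_ineq y z.
have zy : z - y = - (beta^-1 *: g) by rewrite /z addrAC subrr add0r.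
have zx : z - x = (y - x) - beta^-1 *: g by rewrite /z addrAC.
rewrite zx dotrDr dotrNr dotrZr in h1.
rewrite zy dotrNr dotrZr enormN enormZ exprMn ger0_norm ?invr_ge0 ?(ltW beta_gt0)// in h2.
have gg : enorm g ^+ 2 = dotr (grad V y) g - dotr (grad V x) g.
  by rewrite enorm_sqr {1}/g dotrDl dotrNl.
have {}h2 := le_trans h1 h2.
set G := enorm g ^+ 2 in gg h2 *; set p := dotr (grad V x) (y - x) in h2 *.
set a := dotr (grad V y) g in gg h2; set b := dotr (grad V x) g in gg h2.
have e1 : beta / 2 * (beta^-1 ^+ 2 * G) = (2 * beta)^-1 * G by field; rewrite gt_eqF.
have e2 : beta^-1 * a - beta^-1 * b = 2 * ((2 * beta)^-1 * G).
  by rewrite -mulrBr -gg; field; rewrite gt_eqF.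
rewrite e1 in h2; exact: (le_sub2_half e2 h2).
Qed.

(** Adding [grad_half_cocoercive] to itself with [x] and [y] exchanged cancels the values of [V]. *)
Lemma grad_cocoercive x y :
  enorm (grad V x - grad V y) ^+ 2 <= beta * dotr (grad V x - grad V y) (x - y).
Proof.
have h1 := grad_half_cocoercive x y; have h2 := grad_half_cocoercive y x.
have e : enorm (grad V y - grad V x) = enorm (grad V x - grad V y).
  by rewrite -enormN opprB.
rewrite e in h1; set G := enorm _ ^+ 2 in h1 h2 *.
have -> : dotr (grad V x - grad V y) (x - y) =
    - dotr (grad V x) (y - x) - dotr (grad V y) (x - y).
  by rewrite dotrDl dotrNl -(opprB x y) dotrNr opprK.
have h : beta^-1 * G <= - dotr (grad V x) (y - x) - dotr (grad V y) (x - y).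
  have -> : beta^-1 * G = 2 * ((2 * beta)^-1 * G) by field; rewrite gt_eqF.
  exact: (le_add_cross h1 h2).
by rewrite -ler_pdivrMl.
Qed.

(** With [D] the gap and [g] the difference of gradients, the new squared gap is
    [|D|^2 - 2 h <g, D> + h^2 |g|^2]. Co-coercivity absorbs the last term into the second, leaving
    the factor [2 h - h^2 beta] in front of [<g, D>], which is at least [alpha |D|^2]. Finally
    [1 - t <= exp (- t)]; the exponential form gives a rate that tends to [alpha] with [h]. *)
Lemma gradient_step_contr (h : R) x y : 0 < h -> h * beta <= 1 ->
  enorm ((x - h *: grad V x) - (y - h *: grad V y)) <=
  expR (- (alpha * (1 - h * beta / 2)) * h) * enorm (x - y).
Proof.
move=> h0 hb.
have /andP[gm _] := grad_mono y (x - y) ler01.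
rewrite scale1r subrKC mulr1 -dotrNl -dotrDl in gm.
have gc := grad_cocoercive x y.
have -> : (x - h *: grad V x) - (y - h *: grad V y) =
    (x - y) - h *: (grad V x - grad V y).
  by rewrite scalerBr !opprB addrACA [RHS]addrACA; congr (_ + _); exact: addrC.
set g := grad V x - grad V y in gm gc *; set D := x - y in gm gc *.
rewrite -(@ler_pXn2r _ 2) ?nnegrE ?mulr_ge0 ?enorm_ge0 ?expR_ge0// exprMn.
rewrite enorm_sub_sqr.
set p := dotr g D in gm gc *; set G := enorm g ^+ 2 in gc *; set E := enorm D ^+ 2 in gm *.
have E0 : 0 <= E by exact: sqr_ge0.
have p0 : 0 <= p by apply: le_trans gm; rewrite mulr_ge0.
set k := alpha * (1 - h * beta / 2).
have -> : expR (- k * h) ^+ 2 = expR (- (2 * k * h)).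
  by rewrite -expRM_natl; congr expR; ring.
have := expR_ge1Dx (- (2 * k * h)); move/(ler_wpM2r E0); apply: le_trans.
have hG : h * h * G <= h * h * (beta * p) by rewrite ler_wpM2l// mulr_ge0// ltW.
have hp : (2 * h - h * h * beta) * (alpha * E) <= (2 * h - h * h * beta) * p.
  rewrite ler_wpM2l// subr_ge0; have := ler_wpM2l (ltW h0) hb; rewrite mulr1 mulrA; lra.
rewrite /k; lra.
Qed.

End convexity.

(** * Locally Lipschitz fields and continuous paths *)

Section mx_sup_norm.
Context {R : realType} {m n : nat}.
Implicit Types A : 'M[R]_(m, n).

Lemma ler_coord_norm A i j : `|A i j| <= `|A|.
Proof. have -> : `|A| = mx_norm A by [].
by rewrite mx_normrE; apply/bigmax_geP; right => /=; exists (i, j). Qed.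

Lemma mx_norm_le A (c : R) : 0 <= c -> (forall i j, `|A i j| <= c) -> `|A| <= c.
Proof.
have -> : `|A| = mx_norm A by [].
by move=> c0 Ac; rewrite mx_normrE; apply/bigmax_leP; split => // -[i j] _; exact: Ac.
Qed.

End mx_sup_norm.

Section locally_lipschitz.
Context {R : realType} {d : nat}.
Implicit Types (x y : 'rV[R]_d).

Definition loc_lipschitz (g : 'rV[R]_d -> 'rV[R]_d) : Prop := forall M : R,
  exists2 K : R, 0 <= K & forall x y, `|x| <= M -> `|y| <= M -> `|g x - g y| <= K * `|x - y|.

(** The Hessian is continuous, hence bounded on the compact ball of radius [M]; the ball is convex,
    so the mean value theorem applies to each coordinate of the gradient along the segment. *)
Lemma C2_grad_loc_lipschitz f : C2 f -> loc_lipschitz (grad f).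
Proof.
move=> [_ dg ch] M.
have cB : compact [set x : 'rV[R]_d | `|x| <= M].
  apply: bounded_closed_compact.
    by exists M; split; [exact: num_real|move=> y My x /= xM; apply: le_trans xM (ltW My)].
  rewrite (_ : [set _ | _] = (fun z : 'rV[R]_d => `|z|) @^-1` [set t : R | t <= M]);
    last by apply/seteqP; split.
  by apply: preimage_closed => [x _|]; [exact: norm_continuous|exact: closed_le].
have [C [Creal HC]] : bounded_set (hess f @` [set x | `|x| <= M]).
  by apply: compact_bounded; apply: continuous_compact => //; exact: continuous_subspaceT.
pose K := `|C| + 1.
have K0 : 0 <= K by rewrite addr_ge0.
have hK x : `|x| <= M -> `|hess f x| <= K.
  move=> xM; apply: (HC K); first by rewrite (le_lt_trans (ler_norm C))// ltrDl.
  by exists x.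
(* In the sup norm, each coordinate of the product of the Hessian with a vector is a sum of [d]
   terms. *)
exists (K *+ d); first by rewrite mulrn_wge0.
move=> x y xM yM; apply: mx_norm_le; first by rewrite mulr_ge0// mulrn_wge0.
move=> i0 i; rewrite ord1 {i0}.
set v := x - y.
have gi z : grad f z 0 i = dotr (grad f z) (delta_mx 0 i).
  rewrite /dotr (bigD1 i)//= big1 ?addr0 => [|j ji].
    by rewrite !mxE !eqxx mulr1.
  by rewrite !mxE eqxx (negPf ji) mulr0.
have [c /andP[c0 c1]] := MVT01 ltr01
  (fun s => is_derive_grad_line (delta_mx 0 i) (dg (y + s *: v))).
rewrite scale0r addr0 scale1r mulr1 subrKC -!gi => E.
rewrite (_ : forall a b : 'rV[R]_d, (a - b) 0 i = a 0 i - b 0 i); last by move=> a b; rewrite !mxE.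
rewrite E.
have zM : `|y + c *: v| <= M.
  rewrite (_ : y + c *: v = c *: x + (1 - c) *: y); last first.
    by rewrite /v scalerBr scalerBl scale1r addrCA.
  rewrite (le_trans (ler_normD _ _))// !normrZ.
  rewrite ger0_norm ?(ltW c0)// ger0_norm ?subr_ge0 ?(ltW c1)//.
  have := ler_wpM2l (ltW c0) xM; have c1' : 0 <= 1 - c by rewrite subr_ge0 ltW.
  have := ler_wpM2l c1' yM; lra.
rewrite (_ : (_ *m _ *m _) 0 0 = \sum_(j < d) v 0 j * hess f (y + c *: v) i j); last first.
  rewrite mxE (bigD1 i)//= big1 ?addr0 => [|j ji].
    by rewrite !mxE !eqxx mulr1; apply: eq_bigr => j _; rewrite !mxE.
  by rewrite !mxE eqxx (negPf ji) mulr0.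
rewrite (le_trans (ler_norm_sum _ _ _))// mulrnAl.
have -> : K * `|v| *+ d = \sum_(j < d) K * `|v| by rewrite sumr_const card_ord.
apply: ler_sum => j _; rewrite normrM mulrC.
by rewrite ler_pM// ?ler_coord_norm// (le_trans (ler_coord_norm _ _ _))// hK.
Qed.

Lemma loc_lipschitzD g1 g2 : loc_lipschitz g1 -> loc_lipschitz g2 ->
  loc_lipschitz (fun x => g1 x + g2 x).
Proof.
move=> h1 h2 M; have [K1 K10 L1] := h1 M; have [K2 K20 L2] := h2 M.
exists (K1 + K2); first by rewrite addr_ge0.
move=> x y xM yM; rewrite opprD addrACA (le_trans (ler_normD _ _))// mulrDl.
by rewrite lerD ?L1 ?L2.
Qed.

Lemma loc_lipschitz_continuous g : loc_lipschitz g -> continuous g.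
Proof.
move=> lg x; have [K K0 L] := lg (`|x| + 1).
apply/(@cvgrPdist_lt _ _ _ (nbhs x) (nbhs_filter x)) => e e0.
have K1 : 0 < K + 1 by rewrite ltr_wpDl.
have : 0 < Num.min 1 (e / (K + 1)) by rewrite lt_min ltr01 divr_gt0.
move=> /nbhsx_ballx -/(_ _ x); apply: filterS => y.
rewrite -ball_normE /= lt_min => /andP[xy1 xye].
apply: (@le_lt_trans _ _ (K * `|x - y|)).
  apply: L; first by rewrite lerDl.
  rewrite -[y](subrK x) addrC (le_trans (ler_normD _ _))// lerD2l distrC ltW//.
rewrite ltr_pdivlMr// in xye; apply: le_lt_trans xye.
by rewrite mulrC ler_wpM2l// lerDl.
Qed.

End locally_lipschitz.

Section uniform_continuity.
Context {R : realType} {d : nat}.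
Variables (x : R -> 'rV[R]_d).
Hypothesis cx : {within `[0, +oo[, continuous x}.

Lemma path_cvg_within (t e : R) : 0 <= t -> 0 < e ->
  exists2 eta : R, 0 < eta & forall s, 0 <= s -> `|s - t| < eta -> `|x t - x s| < e.
Proof.
move=> t0 e0; have := (@subspace_continuousP R `[0, +oo[%classic _ x).1 cx t.
rewrite /= in_itv/= t0 => /(_ isT)/cvgrPdist_lt/(_ e e0).
rewrite near_withinE => /nbhs_ballP[eta /= eta0 H]; exists eta => // s s0 st.
by apply: H; rewrite /= ?in_itv/= ?s0// -ball_normE /= distrC.
Qed.

Lemma path_unif_continuous (T e : R) : 0 < e -> exists2 eta : R, 0 < eta &
  forall s t, 0 <= s <= T -> 0 <= t <= T -> `|s - t| < eta -> `|x t - x s| <= e.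
Proof.
move=> e0.
(* Compactness in its filter form, with the modulus [eta] ranging over the filter of positive
   numbers near 0: a modulus around each time becomes one for all times. *)
have := (compact_near_coveringP `[0, T]%classic).1 (@segment_compact R 0 T) R
  (0^'+) (fun eta t => 0 <= t <= T -> forall s, 0 <= s <= T -> `|s - t| < eta -> `|x t - x s| <= e) _.
move=> /(_ _)[].
  move=> t; rewrite /= in_itv/= => /andP[t0 tT].
  have [eta eta0 H] := path_cvg_within t0 (divr_gt0 e0 (ltr0n R 2)).
  have eta20 : 0 < eta / 2 by rewrite divr_gt0.
  exists (ball t (eta / 2), [set u : R | 0 < u < eta / 2]).
    split; first exact: nbhsx_ballx.
    near=> u; rewrite /=; apply/andP; split; near: u; [exact: nbhs_right_gt|exact: nbhs_right_lt].
  move=> [t' u] /= [+ /andP[u0 ue]] /andP[t'0 t'T] s /andP[s0 sT] st'.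
  rewrite -ball_normE /= => tt'.
  have h1 : `|x t - x t'| < e / 2.
    by apply: H => //; rewrite distrC (lt_trans tt')// ltr_pdivrMr// ltr_pMr// ltr1n.
  have h2 : `|x t - x s| < e / 2.
    apply: H => //; rewrite -(subrKA t') [eta]splitr (le_lt_trans (ler_normD _ _))//.
    by rewrite ltrD// ?(lt_trans st')// distrC.
  rewrite -(subrKA (x t)) [e]splitr (le_trans (ler_normD _ _))// lerD ?ltW//.
  by rewrite distrC.
move=> eta /= eta0 H.
exists (eta / 2); first by rewrite divr_gt0.
move=> s t sT tT st; have := H (eta / 2) _ _ t; apply => //.
- by rewrite /ball_ /= sub0r normrN gtr0_norm ?divr_gt0// ltr_pdivrMr// ltr_pMr// ltr1n.
- by rewrite divr_gt0.
Unshelve. all: by end_near. Qed.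

Lemma path_bounded (T : R) : exists M : R, forall t, 0 <= t <= T -> `|x t| <= M.
Proof.
have c : compact (x @` `[0, T]).
  apply: continuous_compact (@segment_compact R 0 T).
  apply: continuous_subspaceW cx => t /=; rewrite !in_itv/= => /andP[-> _]//.
have [M [Mr H]] := compact_bounded c.
exists (`|M| + 1) => t tT; apply: H; first by rewrite (le_lt_trans (ler_norm M))// ltrDl.
by exists t => //=; rewrite in_itv.
Qed.

End uniform_continuity.

(** Used with [c = f a], this is the local error of the Euler scheme on one time step. *)
Lemma Rintegral_increment {R : realType} (f : R -> R) (a b c e : R) : 0 <= a -> a <= b ->
  {within `[0, b], continuous f} -> (forall s, a <= s <= b -> `|c - f s| <= e) ->
  `|\int[@lebesgue_measure R]_(s in `[0, b]) f s -
    \int[@lebesgue_measure R]_(s in `[0, a]) f s - (b - a) * c| <= (b - a) * e.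
Proof.
move=> a0 ab cf fc.
have i0 : lebesgue_measure.-integrable `[0, b] (EFin \o f).
  by apply: continuous_compact_integrable => //; exact: segment_compact.
rewrite (Rintegral_itvB i0) ?bnd_simp//.
have iab : lebesgue_measure.-integrable `]a, b] (EFin \o f).
  apply: integrableS i0 => //; apply: subset_itvr; by rewrite bnd_simp.
have lab : fine (@lebesgue_measure R `]a, b]) = b - a.
  rewrite lebesgue_measure_itv/= lte_fin; case: ltP => //= ba.
  by apply/esym/eqP; rewrite subr_eq0 eq_le ab ba.
have icst (k : R) : lebesgue_measure.-integrable `]a, b] (EFin \o (fun=> k)).
  apply: integrableS (_ : lebesgue_measure.-integrable `[0, b] (EFin \o (fun=> k))) => //.
    apply: subset_itvr; by rewrite bnd_simp.
  apply: continuous_compact_integrable; first exact: segment_compact.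
  by apply: continuous_subspaceT => x; exact: cvg_cst.
have icE (k : R) : \int[@lebesgue_measure R]_(s in `]a, b]) k = k * (b - a).
  by rewrite Rintegral_cst// lab.
have fs s : a < s <= b -> c - e <= f s <= c + e.
  move=> /andP[as_ sb]; have := fc s; rewrite (ltW as_) sb => /(_ isT).
  by rewrite distrC ler_distl.
have lo : (c - e) * (b - a) <= \int[@lebesgue_measure R]_(s in `]a, b]) f s.
  rewrite -icE; apply: le_Rintegral => // s /=; rewrite in_itv/= => /fs /andP[]//.
have hi : \int[@lebesgue_measure R]_(s in `]a, b]) f s <= (c + e) * (b - a).
  rewrite -icE; apply: le_Rintegral => // s /=; rewrite in_itv/= => /fs /andP[]//.
move: lo hi; set I := Rintegral _ _ _ => lo hi.
by rewrite ler_norml; apply/andP; split; lra.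
Qed.

(** * Convergence of the Euler scheme *)

Section euler_scheme.
Context {R : realType} {d : nat}.
Implicit Types (x B : R -> 'rV[R]_d) (g : 'rV[R]_d -> 'rV[R]_d).

Definition euler_drift g (h : R) (y : 'rV[R]_d) : 'rV[R]_d := y - h *: g y.

Fixpoint euler_chain g (h : R) B (y : 'rV[R]_d) (k : nat) : 'rV[R]_d :=
  match k with
  | 0 => y
  | k'.+1 => euler_drift g h (euler_chain g h B y k') +
      Num.sqrt 2 *: (B (k'.+1%:R * h) - B (k'%:R * h))
  end.

Definition langevin_path g B x : Prop := forall t : R, 0 <= t -> forall i,
  x t 0 i = x 0 0 i - \int[@lebesgue_measure R]_(s in `[0, t]) g (x s) 0 i
            + Num.sqrt 2 * B t 0 i.

(** Discrete Gronwall argument: the bound [Y_k = eps * ((1 + h * K) ^+ k - 1)] solves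
    [Y_(k+1) = Y_k + h * K * (Y_k + eps)]. The constant [K] is valid only on the ball of radius
    [M + 1]; the hypothesis on [eps] keeps the error below 1, so the chain never leaves that
    ball. *)
Lemma euler_error g B x (h T K M eps : R) (N : nat) :
  {within `[0, +oo[, continuous x} -> langevin_path g B x -> continuous g ->
  0 <= h -> N%:R * h <= T -> 0 <= K -> 0 <= eps ->
  (forall t, 0 <= t <= T -> `|x t| <= M) ->
  (forall y z, `|y| <= M + 1 -> `|z| <= M + 1 -> `|g y - g z| <= K * `|y - z|) ->
  (forall s t, 0 <= s <= T -> 0 <= t <= T -> `|s - t| <= h -> `|x t - x s| <= eps) ->
  eps * expR (K * T) <= 1 ->
  forall k, (k <= N)%N ->
  `|euler_chain g h B (x 0) k - x (k%:R * h)| <= eps * ((1 + h * K) ^+ k - 1).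
Proof.
move=> cx eqx cg h0 NhT K0 e0 xM gK xe eK1; elim=> [_|k IH kN].
  by rewrite mul0r subrr normr0 expr0 subrr mulr0.
have kh0 j : 0 <= j%:R * h by rewrite mulr_ge0.
have khT j : (j <= N)%N -> j%:R * h <= T.
  by move=> jN; apply: le_trans NhT; rewrite ler_wpM2r// ler_nat.
set a := k%:R * h; set b := k.+1%:R * h.
have ba : b - a = h by rewrite /b /a -mulrBl -natrB// subSnn mul1r.
have aT : 0 <= a <= T by rewrite kh0 khT// ltnW.
have bT : 0 <= b <= T by rewrite kh0 khT.
have ab : a <= b by rewrite -subr_ge0 ba.
have {}IH := IH (ltnW kN); rewrite -/a in IH.
set X := euler_chain g h B (x 0) k in IH *.
have hK0 : 0 <= h * K by rewrite mulr_ge0.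
have le1 : eps * ((1 + h * K) ^+ k - 1) <= 1.
  apply: (le_trans _ eK1); rewrite ler_wpM2l// lerBlDr.
  apply: (@le_trans _ _ (expR (h * K) ^+ k)).
    by rewrite lerXn2r ?nnegrE ?expR_ge0 ?addr_ge0 ?expR_ge1Dx.
  rewrite -expRM_natl (@le_trans _ _ (expR (K * T)))// ?lerDl ?ler01// ler_expR.
  rewrite [leLHS]mulrA mulrC -[k%:R * h]/a ler_wpM2l//; by case/andP: aT.
have XM : `|X| <= M + 1.
  rewrite -(subrK (x a) X) addrC (le_trans (ler_normD _ _))// lerD ?xM//.
  exact: le_trans le1.
have xaM : `|x a| <= M + 1 by rewrite (le_trans (xM _ aT))// lerDl.
have M0 : 0 <= M by rewrite (le_trans _ (xM a aT)).
have Y0 : 0 <= eps * ((1 + h * K) ^+ k - 1).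
  by rewrite mulr_ge0// subr_ge0 exprn_ege1// lerDl.
set Y := eps * ((1 + h * K) ^+ k - 1) in IH le1 Y0.
have -> : eps * ((1 + h * K) ^+ k.+1 - 1) = Y + h * (K * Y) + h * (K * eps).
  by rewrite /Y exprS; ring.
have KY0 : 0 <= K * Y by exact: mulr_ge0.
have Ke0 : 0 <= K * eps by exact: mulr_ge0.
apply: mx_norm_le; first by apply: addr_ge0; [apply: addr_ge0 => //|]; exact: mulr_ge0.
move=> i0 i; rewrite ord1 {i0}.
have cgx : {within `[0, b], continuous (fun s => g (x s) 0 i)}.
  have cx' : {within `[0, b], continuous x}.
    by apply: continuous_subspaceW cx => t /=; rewrite !in_itv/= => /andP[-> _].
  move=> t; apply: (@continuous_comp _ _ _ (x : subspace `[0, b] -> 'rV[R]_d)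
    (fun y => g y 0 i)); first exact: cx'.
  apply: (@continuous_comp _ _ _ g (fun y : 'rV[R]_d => y 0 i)); first exact: cg.
  exact: coord_continuous.
have /andP[a0 _] := aT; have /andP[b0 _] := bT.
have Iab := @Rintegral_increment R (fun s => g (x s) 0 i) a b (g (x a) 0 i) (K * eps) a0 ab cgx.
rewrite ba in Iab.
have {}Iab : `|\int[lebesgue_measure]_(s in `[0, b]) g (x s) 0 i -
    \int[lebesgue_measure]_(s in `[0, a]) g (x s) 0 i - h * g (x a) 0 i| <= h * (K * eps).
  apply: Iab => s /andP[as_ sb].
  have sT : 0 <= s <= T by rewrite (le_trans a0)//= (le_trans sb)//; case/andP: bT.
  rewrite (_ : forall u v : 'rV[R]_d, u 0 i - v 0 i = (u - v) 0 i); last by move=> u v; rewrite !mxE.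
  rewrite (le_trans (ler_coord_norm _ _ _))// (le_trans (gK _ _ xaM _))//.
    by rewrite (le_trans (xM _ sT))// lerDl.
  rewrite ler_wpM2l// xe// ger0_norm ?subr_ge0// -ba lerD2r//.
have gXa : `|g X 0 i - g (x a) 0 i| <= K * Y.
  rewrite (_ : forall u v : 'rV[R]_d, u 0 i - v 0 i = (u - v) 0 i); last by move=> u v; rewrite !mxE.
  by rewrite (le_trans (ler_coord_norm _ _ _))// (le_trans (gK _ _ XM xaM))// ler_wpM2l.
have Xa : `|X 0 i - x a 0 i| <= Y.
  rewrite (_ : forall u v : 'rV[R]_d, u 0 i - v 0 i = (u - v) 0 i); last by move=> u v; rewrite !mxE.
  by rewrite (le_trans (ler_coord_norm _ _ _)).
have ea := eqx a a0 i; have eb := eqx b b0 i.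
have Echain : euler_chain g h B (x 0) k.+1 0 i =
  X 0 i - h * g X 0 i + Num.sqrt 2 * (B b 0 i - B a 0 i) by rewrite !mxE.
rewrite (_ : forall u v : 'rV[R]_d, (u - v) 0 i = u 0 i - v 0 i); last by move=> u v; rewrite !mxE.
rewrite Echain -/b.
set Ia := Rintegral _ _ _ in ea Iab; set Ib := Rintegral _ _ _ in eb Iab.
(* The Brownian increments of the chain and of the path cancel exactly, the noise being additive. *)
have -> : X 0 i - h * g X 0 i + Num.sqrt 2 * (B b 0 i - B a 0 i) - x b 0 i =
  (X 0 i - x a 0 i) - h * (g X 0 i - g (x a) 0 i) + (Ib - Ia - h * g (x a) 0 i).
  by rewrite eb ea; ring.
rewrite (le_trans (ler_normD _ _))// lerD// (le_trans (ler_normB _ _))// lerD//.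
by rewrite normrM ger0_norm// ler_wpM2l.
Qed.

Lemma euler_chain_cvg g B x (T : R) : {within `[0, +oo[, continuous x} ->
  langevin_path g B x -> loc_lipschitz g -> 0 < T ->
  euler_chain g (T / N.+1%:R) B (x 0) N.+1 @[N --> \oo] --> x T.
Proof.
move=> cx eqx lg T0.
have [M xM] := path_bounded cx T; have [K K0 gK] := lg (M + 1).
apply/cvgrPdist_le => e e0.
(* The final error is at most [eps * expR (K * T) = Num.min 1 e]: the 1 confines the chain to the
   ball, the [e] is the precision sought. *)
pose eps := Num.min 1 e * expR (- (K * T)).
have me0 : 0 < Num.min 1 e by rewrite lt_min ltr01.
have eps0 : 0 < eps by rewrite mulr_gt0// expR_gt0.
have epsK : eps * expR (K * T) = Num.min 1 e by rewrite -mulrA -expRD addNr expR0 mulr1.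
have [eta eta0 xe] := path_unif_continuous cx T eps0.
near=> N.
have h0 : 0 < T / N.+1%:R by rewrite divr_gt0.
have NhT : N.+1%:R * (T / N.+1%:R) = T by rewrite mulrC divfK// pnatr_eq0.
have heta : T / N.+1%:R < eta.
  rewrite ltr_pdivrMr// mulrC -ltr_pdivrMr//.
  near: N; apply: filterS (nbhs_infty_gtr (T / eta)) => n hn.
  by rewrite (lt_trans hn)// ltr_nat.
have := @euler_error g B x (T / N.+1%:R) T K M eps N.+1 cx eqx (loc_lipschitz_continuous lg)
  (ltW h0) _ K0 (ltW eps0) xM gK _ _ N.+1 (leqnn _).
rewrite NhT epsK => H; rewrite distrC (le_trans (H _ _ _))//.
- by move=> s t sT tT st; apply: xe => //; exact: le_lt_trans heta.
- by rewrite ge_min lexx.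
- apply: (@le_trans _ _ (eps * expR (K * T))); last by rewrite epsK ge_min lexx orbT.
  rewrite ler_wpM2l ?(ltW eps0)// lerBlDr.
  rewrite (@le_trans _ _ (expR (K * T)))// ?lerDl ?ler01//.
  apply: (@le_trans _ _ (expR (T / N.+1%:R * K) ^+ N.+1)).
    have hK0 : 0 <= T / N.+1%:R * K by rewrite mulr_ge0// ltW.
    by rewrite lerXn2r ?nnegrE ?expR_ge0 ?expR_ge1Dx// addr_ge0.
  by rewrite -expRM_natl mulrA NhT mulrC.
Unshelve. all: by end_near. Qed.

End euler_scheme.

(** * Law of the Euler chain and its limit *)

Section independence.
Context {dO d1 d2 : measure_display} {Omega : measurableType dO}
  {T1 : measurableType d1} {T2 : measurableType d2} {R : realType}.
Variables (P : probability Omega R) (gam : probability T2 R) (Y : Omega -> T1) (Z : Omega -> T2).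
Hypotheses (mY : measurable_fun setT Y) (mZ : measurable_fun setT Z).
Hypothesis indep : forall A C, measurable A -> measurable C ->
  P (Y @^-1` A `&` Z @^-1` C) = (P (Y @^-1` A) * gam C)%E.

(** By [indep], the joint law of [Y] and [Z] agrees with a product measure on rectangles, hence
    everywhere, and Fubini applies. *)
Lemma mean_indep (f : T1 * T2 -> R) : bmeas f ->
  \int[P]_w f (Y w, Z w) = \int[P]_w \int[gam]_z f (Y w, z).
Proof.
move=> bf.
pose Ym : {mfun Omega >-> T1} := HB.pack Y (isMeasurableFun.Build _ _ _ _ Y mY).
pose PY : probability T1 R := distribution P Ym.
have mYZ : measurable_fun setT (fun w => (Y w, Z w)) by exact: measurable_fun_pair.
have E A : measurable A -> P ((fun w => (Y w, Z w)) @^-1` A) = (PY \x gam)%E A.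
  move=> mA.
  apply/esym; apply: (@product_measure_unique _ _ _ _ _ PY gam
    (measure_function_pushforward__canonical__measure_function_Measure P mYZ)) => //.
rewrite (mean_law mYZ E bf) mean_prod//.
exact/esym/(mean_law (m := PY) mY (fun _ _ => erefl) (bmeas_fubini PY gam bf)).
Qed.

End independence.

Section euler_law.
Context {R : realType} {d : nat} {dO : measure_display} {Omega : measurableType dO}.
Variables (P : probability Omega R) (F : R -> set (set Omega)) (B X : R -> Omega -> 'rV[R]_d).
Variables (g : 'rV[R]_d -> 'rV[R]_d).
Hypotheses (bmB : brownian_motion P F B) (aX : adapted F X) (cg : continuous g).

(** Turns [F t] into a measurable space, so that adaptedness becomes measurability and composes as
    such. It is a generated sigma-algebra because [F t] is known to be one only for [t >= 0]. *)
Let Ft (t : R) := g_sigma_algebraType (F t).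

Lemma filtration_measurable (t : R) (A : set Omega) : 0 <= t ->
  (@measurable _ (Ft t) A) = F t A.
Proof.
move=> t0; have [/(_ t t0)[sF _] _] := bm_filtration bmB.
by rewrite /measurable/= (sigma_algebra_id sF).
Qed.

Lemma adapted_measurable_fun (W : R -> Omega -> 'rV[R]_d) (t : R) : 0 <= t -> adapted F W ->
  measurable_fun (setT : set (Ft t)) (W t : Ft t -> 'rV[R]_d).
Proof.
by move=> t0 aW _ A mA; rewrite setTI filtration_measurable//; exact: aW.
Qed.

Lemma filtration_measurable_funW (s t : R) (f : Omega -> 'rV[R]_d) : 0 <= s -> s <= t ->
  measurable_fun (setT : set (Ft s)) (f : Ft s -> 'rV[R]_d) ->
  measurable_fun (setT : set (Ft t)) (f : Ft t -> 'rV[R]_d).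
Proof.
move=> s0 st mf _ A mA; have := mf measurableT A mA; rewrite !setTI.
rewrite !filtration_measurable//; last exact: le_trans st.
have [_ /(_ s t s0 st)] := bm_filtration bmB; exact.
Qed.

Lemma filtration_measurable_funT (t : R) (f : Omega -> 'rV[R]_d) : 0 <= t ->
  measurable_fun (setT : set (Ft t)) (f : Ft t -> 'rV[R]_d) -> measurable_fun setT f.
Proof.
move=> t0 mf _ A mA; have := mf measurableT A mA; rewrite !setTI filtration_measurable//.
by have [/(_ t t0)[_] + _] := bm_filtration bmB; exact.
Qed.

Lemma measurable_euler_drift (h : R) : measurable_fun setT (euler_drift g h).
Proof.
apply: measurable_fun_rV => i; under eq_fun do rewrite !mxE.
have mg : measurable_fun setT (fun y => g y 0 i).
  apply: (measurability _ (RGenOInfty.measurableE R)) => _ [_ [a ->] <-].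
  rewrite setTI; apply: open_measurable_rV.
  apply: open_comp; last exact: interval_open.
  move=> v _; apply: (@continuous_comp _ _ _ g (fun y : 'rV[R]_d => y 0 i)); first exact: cg.
  exact: coord_continuous.
apply: measurable_funB; first exact: measurable_coord_rV.
by apply: measurable_funM.
Qed.

Variable h : R.
Hypothesis h0 : 0 < h.

Let chain k (w : Omega) := euler_chain g h (fun t => B t w) (X 0 w) k.
Let tk0 k : 0 <= k%:R * h :> R. Proof. by rewrite mulr_ge0// ltW. Qed.
Let tkS k : k%:R * h <= k.+1%:R * h :> R. Proof. by apply: ler_wpM2r; [exact: ltW|rewrite ler_nat]. Qed.

Lemma euler_chain_adapted k :
  measurable_fun (setT : set (Ft (k%:R * h))) (chain k : Ft (k%:R * h) -> 'rV[R]_d).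
Proof.
elim: k => [|k IH].
  have := adapted_measurable_fun (tk0 0) aX; by rewrite mul0r.
rewrite /chain /=; apply: measurable_rV_affine.
  apply: (measurableT_comp (measurable_euler_drift h)).
  exact: filtration_measurable_funW (tkS k) IH.
have -> : (fun w => B (k.+1%:R * h) w - B (k%:R * h) w) =
    (fun w => B (k.+1%:R * h) w + (-1) *: B (k%:R * h) w).
  by apply/funext => w; rewrite scaleN1r.
have aB := bm_adapted bmB.
apply: measurable_rV_affine; first exact: adapted_measurable_fun.
apply: (filtration_measurable_funW (tk0 k) (tkS k)); exact: adapted_measurable_fun.
Qed.

Lemma measurable_euler_chain k : measurable_fun setT (chain k).
Proof. exact: (filtration_measurable_funT (tk0 k) (@euler_chain_adapted k)). Qed.

Lemma measurable_increment k : measurable_fun setT (increment B (k%:R * h) (k.+1%:R * h)).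
Proof.
have aB := bm_adapted bmB.
have -> : increment B (k%:R * h) (k.+1%:R * h) =
    (fun w => B (k.+1%:R * h) w + (-1) *: B (k%:R * h) w).
  by apply/funext => w; rewrite /increment scaleN1r.
apply: measurable_rV_affine; apply: (filtration_measurable_funT (tk0 _));
  exact: adapted_measurable_fun.
Qed.

Lemma increment_law k A : measurable A ->
  P (increment B (k%:R * h) (k.+1%:R * h) @^-1` A) = gauss_rV d (Num.sqrt h) A.
Proof.
move=> mA; have mI := measurable_increment k.
apply: (gauss_rV_unique (m :=
  measure_function_pushforward__canonical__measure_function_Measure P mI)) => // C mC.
rewrite [LHS](bm_normal bmB (tk0 k) _ mC); last by rewrite ltr_pM2r// ltr_nat.
suff -> : k.+1%:R * h - k%:R * h = h by [].
by rewrite -mulrBl -natrB// subSnn mul1r.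
Qed.

(** Markov property: the last increment is independent of the chain at time [k%:R * h], so
    integrating it out replaces [phi] by [euler_op] of [phi] and leaves a chain of [k] steps. *)
Lemma mean_euler_chain k (phi : 'rV[R]_d -> R) : bmeas phi ->
  \int[P]_w phi (chain k w) = \int[P]_w iter k (euler_op (euler_drift g h) h) phi (X 0 w).
Proof.
elim: k phi => [//|k IH] phi bphi.
have mD := measurable_euler_drift h.
rewrite iterSr -IH; last exact: bmeas_euler_op.
pose f (p : 'rV[R]_d * 'rV[R]_d) := phi (euler_drift g h p.1 + Num.sqrt 2 *: p.2).
have bf : bmeas f by exact: (bmeas_comp bphi (measurable_euler_step mD)).
apply: (@mean_indep _ _ _ _ _ _ _ P (gauss_rV d (Num.sqrt h)) (chain k)
  (increment B (k%:R * h) (k.+1%:R * h)) _ _ _ f bf).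
- exact: measurable_euler_chain.
- exact: measurable_increment.
move=> A C mA mC; rewrite -(increment_law k mC).
apply: (bm_indep bmB (tk0 k) (tkS k) _ mC); rewrite -filtration_measurable//.
by have := @euler_chain_adapted k measurableT A mA; rewrite setTI.
Qed.

End euler_law.

Lemma bmeas_continuous {R : realType} {d : nat} (phi : 'rV[R]_d -> R) (M : R) :
  continuous phi -> (forall x, `|phi x| <= M) -> bmeas phi.
Proof.
move=> cphi phiM; split; last by exists M.
apply: (measurability _ (RGenOInfty.measurableE R)) => _ [_ [a ->] <-].
rewrite setTI; apply: open_measurable_rV.
by apply: open_comp; [move=> v _; exact: cphi|exact: interval_open].
Qed.

Section euler_law_cvg.
Context {R : realType} {d : nat} {dO : measure_display} {Omega : measurableType dO}.
Variables (P : probability Omega R) (F : R -> set (set Omega)) (B X : R -> Omega -> 'rV[R]_d).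
Variables (U : 'rV[R]_d -> R) (T : R) (mu muT : probability 'rV[R]_d R).
Hypotheses (sol : langevin_solution P U F B X) (lU : loc_lipschitz (grad U)) (T0 : 0 < T).
Hypotheses (X0 : has_law P (X 0) mu) (XT : has_law P (X T) muT).

Definition euler_mean (h : R) k (m : probability 'rV[R]_d R) (phi : 'rV[R]_d -> R) : R :=
  \int[m]_x iter k (euler_op (euler_drift (grad U) h) h) phi x.

(** The chain driven by the Brownian motion of the solution converges to [X T] almost surely, and
    dominated convergence applies. The left-hand mean involves [mu] only and no longer the
    probability space. *)
Lemma euler_mean_cvg (phi : 'rV[R]_d -> R) (M : R) : continuous phi ->
  (forall x, `|phi x| <= M) ->
  euler_mean (T / N.+1%:R) N.+1 mu phi @[N --> \oo] --> \int[muT]_x phi x.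
Proof.
move=> cphi phiM; have bphi := bmeas_continuous cphi phiM.
have [bmB aX cX eqX] := sol.
have cg := loc_lipschitz_continuous lU.
have mX t : 0 <= t -> measurable_fun setT (X t).
  by move=> t0; exact: (filtration_measurable_funT bmB t0 (adapted_measurable_fun bmB t0 aX)).
have hN N : 0 < T / N.+1%:R by rewrite divr_gt0.
pose chain N w := euler_chain (grad U) (T / N.+1%:R) (fun t => B t w) (X 0 w) N.+1.
have mch N : measurable_fun setT (chain N) by exact: (measurable_euler_chain bmB aX cg (hN N)).
have E N : euler_mean (T / N.+1%:R) N.+1 mu phi = \int[P]_w phi (chain N w).
  rewrite (mean_euler_chain bmB aX cg (hN N) _ bphi) /euler_mean.
  apply/esym; apply: (mean_law (mX _ (lexx 0)) X0).
  by apply: bmeas_iter_euler_op => //; exact: measurable_euler_drift.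
rewrite -(mean_law (mX _ (ltW T0)) XT bphi).
under eq_fun do rewrite E.
have [] := @dominated_convergence _ _ _ P setT measurableT
  (fun N w => (phi (chain N w))%:E) (fun w => (phi (X T w))%:E) (fun=> M%:E).
- move=> N; apply/measurable_EFinP; exact: (measurableT_comp bphi.1 (mch N)).
- apply/measurable_EFinP; exact: (measurableT_comp bphi.1 (mX _ (ltW T0))).
- apply: filterS2 cX eqX => w cw eqw _.
  apply: cvg_EFin; first by near=> N.
  apply: (@cvg_comp _ _ _ (fun N => chain N w) phi _ (nbhs (X T w))); last exact: cphi.
  exact: (euler_chain_cvg cw eqw lU T0).
- exact: (bmeas_integrable P (bmeas_cst M)).
- by apply: aeW => w N _; rewrite lee_fin.
move=> _ _; set I := (\int[P]_x _)%E.
have -> : I = (\int[P]_w phi (X T w))%:E.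
  by rewrite EFin_mean//; exact: (bmeas_comp bphi (mX _ (ltW T0))).
move=> /fine_cvgP[_]; apply: cvg_trans; apply: near_eq_cvg; near=> N.
by [].
Unshelve. all: by end_near. Qed.

End euler_law_cvg.

Lemma mean_cvg {dT} {T : measurableType dT} {R : realType} (P : probability T R)
    (f : (T -> R)^nat) (g : T -> R) (M : R) : (forall n, measurable_fun setT (f n)) ->
  measurable_fun setT g -> (forall n x, `|f n x| <= M) ->
  (forall x, f n x @[n --> \oo] --> g x) ->
  \int[P]_x f n x @[n --> \oo] --> \int[P]_x g x.
Proof.
move=> mf mg fM fg.
have bg : bmeas g.
  split => //; exists M => x; apply: (cvgr_to_le (cvg_norm (fg x))).
  by apply: nearW => n; exact: fM.
have [] := @dominated_convergence _ _ _ P setT measurableT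
  (fun n x => (f n x)%:E) (fun x => (g x)%:E) (fun=> M%:E).
- by move=> n; apply/measurable_EFinP.
- exact/measurable_EFinP.
- by apply: aeW => x _; apply: cvg_EFin; [near=> n|exact: fg].
- exact: (bmeas_integrable P (bmeas_cst M)).
- by apply: aeW => x n _; rewrite lee_fin.
move=> _ _; rewrite -EFin_mean// => /fine_cvgP[_].
by apply: cvg_trans; apply: near_eq_cvg; near=> n.
Unshelve. all: by end_near. Qed.

(** * Approximation of measurable functions by continuous ones *)

Section continuous_density.
Context {R : realType} {d : nat}.
Variables P Q : probability 'rV[R]_d R.
Implicit Types f g : 'rV[R]_d -> R.

(** One and the same [g] has to serve for [P] and [Q], as both occur in the Donsker-Varadhan
    inequality. The range is fixed to [0, 1] so that limits are dominated. *)
Definition approximable f : Prop :=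
  [/\ measurable_fun setT f, forall x, 0 <= f x <= 1 &
   forall e : R, 0 < e -> exists g, [/\ continuous g, forall x, 0 <= g x <= 1,
     \int[P]_x `|f x - g x| <= e & \int[Q]_x `|f x - g x| <= e] ].

Let continuous_unit_bmeas g : continuous g -> (forall x, 0 <= g x <= 1) -> bmeas g.
Proof.
move=> cg g01; apply: (@bmeas_continuous R d g 1 cg) => x.
by have /andP[g0 g1] := g01 x; rewrite ger0_norm.
Qed.

Lemma approximable_bmeas f : approximable f -> bmeas f.
Proof. by move=> [mf f01 _]; exact: bmeas_itv mf f01. Qed.

Lemma approximable_continuous g : continuous g -> (forall x, 0 <= g x <= 1) -> approximable g.
Proof.
move=> cg g01; split => //; first by case: (continuous_unit_bmeas cg g01).
move=> e e0; exists g; split => //.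
  by under eq_Rintegral do rewrite subrr normr0; rewrite mean_cst ltW.
by under eq_Rintegral do rewrite subrr normr0; rewrite mean_cst ltW.
Qed.

(** Treats maximum, complement and scaling at once; a unary operation ignores its second
    argument. *)
Lemma approximable_op2 (F : R -> R -> R) f1 f2 :
  measurable_fun setT (fun x => F (f1 x) (f2 x)) ->
  (forall u v, 0 <= u <= 1 -> 0 <= v <= 1 -> 0 <= F u v <= 1) ->
  (forall u v u' v', `|F u v - F u' v'| <= `|u - u'| + `|v - v'|) ->
  (forall g1 g2, continuous g1 -> continuous g2 ->
     continuous (fun x : 'rV[R]_d => F (g1 x) (g2 x))) ->
  approximable f1 -> approximable f2 -> approximable (fun x => F (f1 x) (f2 x)).
Proof.
move=> mF F01 Flip Fc a1 a2; have b1 := approximable_bmeas a1; have b2 := approximable_bmeas a2.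
have [_ f1b h1] := a1; have [_ f2b h2] := a2; split => // [x|e e0]; first exact: F01.
have e20 : 0 < e / 2 by rewrite divr_gt0.
have [g1 [c1 g1b P1 Q1]] := h1 _ e20; have [g2 [c2 g2b P2 Q2]] := h2 _ e20.
have bg1 := continuous_unit_bmeas c1 g1b; have bg2 := continuous_unit_bmeas c2 g2b.
have Gb x : 0 <= F (g1 x) (g2 x) <= 1 by exact: F01.
have bG : bmeas (fun x => F (g1 x) (g2 x)) by apply: continuous_unit_bmeas => //; exact: Fc.
have bF : bmeas (fun x => F (f1 x) (f2 x)).
  by apply: (bmeas_itv mF) => x; exact: F01.
have main (m : probability 'rV[R]_d R) : \int[m]_x `|f1 x - g1 x| <= e / 2 ->
    \int[m]_x `|f2 x - g2 x| <= e / 2 -> \int[m]_x `|F (f1 x) (f2 x) - F (g1 x) (g2 x)| <= e.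
  move=> m1 m2; rewrite [e]splitr; apply: le_trans (lerD m1 m2).
  rewrite -meanD; try by apply: bmeas_norm; exact: bmeasB.
  apply: le_mean => //; first by apply: bmeas_norm; exact: bmeasB.
  by apply: bmeasD; apply: bmeas_norm; exact: bmeasB.
by exists (fun x => F (g1 x) (g2 x)); split; [exact: Fc|exact: Gb|exact: main|exact: main].
Qed.

Lemma approximable_max f1 f2 : approximable f1 -> approximable f2 ->
  approximable (fun x => Num.max (f1 x) (f2 x)).
Proof.
move=> a1 a2; apply: (@approximable_op2 Num.max) (a1) (a2).
- by apply: measurable_maxr; [case: a1|case: a2].
- by move=> u v /andP[u0 u1] /andP[v0 v1]; rewrite le_max u0 ge_max u1 v1.
- move=> u v u' v'.
  have := ler_norm (u - u'); have := ler_norm (v - v').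
  have := ler_norm (u' - u); have := ler_norm (v' - v).
  rewrite (distrC u') (distrC v') ler_norml.
  have := normr_ge0 (u - u'); have := normr_ge0 (v - v').
  move: (`|u - u'|) (`|v - v'|) => a b.
  by rewrite !maxEle; case: ifP => // h1; case: ifP => // h2 ? ? ? ? ? ?;
    apply/andP; split; lra.
- by move=> g1 g2 c1 c2 x; apply: continuous_max; [exact: c1|exact: c2].
Qed.

Lemma approximable_compl f : approximable f -> approximable (fun x => 1 - f x).
Proof.
move=> a; apply: (@approximable_op2 (fun u v => 1 - u) f f) => //.
- by apply: measurable_funB => //; case: a.
- by move=> u v /andP[u0 u1] _; rewrite subr_ge0 u1/= lerBlDr lerDl.
- move=> u v u' v'; rewrite (_ : 1 - u - (1 - u') = - (u - u')); last by ring.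
  by rewrite normrN lerDl.
- move=> g1 g2 c1 c2 x; apply: (@continuous_comp _ _ _ g1 (fun t : R => 1 - t)); first exact: c1.
  by apply: cvgB; [exact: cvg_cst|exact: cvg_id].
Qed.

Lemma approximable_scale (c : R) f : 0 <= c <= 1 -> approximable f ->
  approximable (fun x => c * f x).
Proof.
move=> /andP[c0 c1] a; apply: (@approximable_op2 (fun u v => c * u) f f) => //.
- by apply: measurable_funM => //; case: a.
- by move=> u v /andP[u0 u1] _; rewrite mulr_ge0// mulr_ile1.
- move=> u v u' v'; rewrite -mulrBr normrM (ger0_norm c0).
  by rewrite (@le_trans _ _ `|u - u'|) ?lerDl// ler_piMl.
- move=> g1 g2 c1' c2 x; apply: (@continuous_comp _ _ _ g1 (fun t : R => c * t)); first exact: c1'.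
  by apply: cvgM; [exact: cvg_cst|exact: cvg_id].
Qed.

Lemma approximable_cst (c : R) : 0 <= c <= 1 -> approximable (fun=> c).
Proof. by move=> c01; apply: approximable_continuous => // x; exact: cst_continuous. Qed.

Lemma approximable_lim (f : ('rV[R]_d -> R)^nat) g : (forall n, approximable (f n)) ->
  measurable_fun setT g -> (forall x, 0 <= g x <= 1) ->
  (forall x, f n x @[n --> \oo] --> g x) -> approximable g.
Proof.
move=> af mg g01 fg; split => // e e0.
have e20 : 0 < e / 2 by rewrite divr_gt0.
have bg := bmeas_itv mg g01.
have lim0 (m : probability 'rV[R]_d R) : \forall n \near \oo, \int[m]_x `|g x - f n x| <= e / 2.
  have : \int[m]_x `|g x - f n x| @[n --> \oo] --> \int[m]_x (0 : R).
    apply: (@mean_cvg _ _ _ m _ _ 1).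
    - by move=> n; case: (bmeas_norm (bmeasB bg (approximable_bmeas (af n)))).
    - exact: measurable_cst.
    - move=> n x; have [_ /(_ x)/andP[f0 f1] _] := af n; have /andP[g0 g1] := g01 x.
      by rewrite normr_id ler_norml; apply/andP; split; lra.
    - move=> x; rewrite -(normr0 R) -(subrr (g x)).
      by apply: cvg_norm; apply: cvgB; [exact: cvg_cst|exact: fg].
  rewrite mean_cst => /cvgrPdist_le/(_ _ e20); apply: filterS => n.
  rewrite sub0r normrN ger0_norm//; exact: Rintegral_ge0.
have [n [Pn Qn]] : exists n, \int[P]_x `|g x - f n x| <= e / 2 /\ \int[Q]_x `|g x - f n x| <= e / 2.
  have [n _ H] : \forall n \near \oo,
      \int[P]_x `|g x - f n x| <= e / 2 /\ \int[Q]_x `|g x - f n x| <= e / 2.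
    by near=> n; split; near: n; exact: lim0.
  by exists n; apply: H => /=.
have [_ _ /(_ _ e20)[h [ch h01 Ph Qh]]] := af n.
have bh := continuous_unit_bmeas ch h01; have bfn := approximable_bmeas (af n).
have main (m : probability 'rV[R]_d R) : \int[m]_x `|g x - f n x| <= e / 2 ->
    \int[m]_x `|f n x - h x| <= e / 2 -> \int[m]_x `|g x - h x| <= e.
  move=> m1 m2; rewrite [e]splitr; apply: le_trans (lerD m1 m2).
  rewrite -meanD; try by apply: bmeas_norm; exact: bmeasB.
  apply: le_mean; first by apply: bmeas_norm; exact: bmeasB.
    by apply: bmeasD; apply: bmeas_norm; exact: bmeasB.
  by move=> x; exact: ler_distD.
by exists h; split => //; exact: main.
Unshelve. all: by end_near. Qed.

Lemma indic_unit (A : set 'rV[R]_d) x : 0 <= (\1_A x : R) <= 1.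
Proof. by rewrite indicE; case: (_ \in _); rewrite ?ler01 ?lexx. Qed.

Lemma approximable_halfspace (i : 'I_d) (a : R) :
  approximable \1_[set v : 'rV[R]_d | a < v 0 i].
Proof.
(* Continuous ramps of slope [n] that converge pointwise to the indicator of the open half-space. *)
pose f (n : nat) (v : 'rV[R]_d) : R := Num.min 1 (Num.max 0 (n%:R * (v 0 i - a))).
have mA : measurable [set v : 'rV[R]_d | a < v 0 i].
  rewrite (_ : [set _ | _] = (fun v : 'rV[R]_d => v 0 i) @^-1` `]a, +oo[%classic); last first.
    by apply/seteqP; split => v /=; rewrite in_itv/= andbT.
  by rewrite -[X in measurable X]setTI; exact: measurable_coord_rV.
apply: (@approximable_lim f).
- move=> n; apply: approximable_continuous => [v|v]; last first.
    by rewrite le_min ler01 le_max lexx ge_min lexx.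
  apply: (@continuous_comp _ _ _ (fun v : 'rV[R]_d => v 0 i)
    (fun t : R => Num.min 1 (Num.max 0 (n%:R * (t - a))))); first exact: coord_continuous.
  apply: continuous_min; first exact: cvg_cst.
  apply: continuous_max; first exact: cvg_cst.
  apply: cvgM; first exact: cvg_cst.
  by apply: cvgB; [exact: cvg_id|exact: cvg_cst].
- exact: measurable_indic.
- exact: indic_unit.
move=> v; rewrite indicE; have [av|va] := ltP a (v 0 i).
  rewrite mem_set//; apply: cvg_near_cst; near=> n.
  rewrite /f; have h : 1 <= n%:R * (v 0 i - a).
    rewrite -ler_pdivrMr ?subr_gt0// div1r ltW//.
    by near: n; exact: nbhs_infty_gtr.
  by rewrite max_r ?(le_trans ler01 h)// min_l.
rewrite memNset/=; last by apply/negP; rewrite -leNgt.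
apply: cvg_near_cst; near=> n; rewrite /f max_l ?min_r ?ler01//.
by rewrite mulr_ge0_le0// subr_le0.
Unshelve. all: by end_near. Qed.

Lemma sigma_algebra_approximable :
  sigma_algebra setT [set A : set 'rV[R]_d | approximable \1_A].
Proof.
split => /=.
- by rewrite indic0; apply: approximable_cst; rewrite lexx ler01.
- move=> A aA; rewrite setTD; rewrite (_ : \1_(~` A) = (fun x => 1 - \1_A x)).
    exact: approximable_compl.
  apply/funext => x; rewrite !indicE in_setC; case: (_ \in _) => /=; rewrite ?subrr ?subr0//.
move=> A aA.
have mA n : measurable (A n).
  have [mf _ _] := aA n; have := mf measurableT [set 1] (measurable_set1 1).
  rewrite setTI (_ : _ @^-1` _ = A n)//; apply/seteqP; split => x /=; rewrite indicE.
    by case: (boolP (x \in A n)) => [/set_mem//|_ /= /eqP]; rewrite eq_sym oner_eq0.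
  by move=> /mem_set ->.
apply: (@approximable_lim (fun n => \1_(\big[setU/set0]_(i < n) A i))).
- elim=> [|n IH].
    by rewrite big_ord0 indic0; apply: approximable_cst; rewrite lexx ler01.
  rewrite big_ord_recr /=; set U := \big[_/_]_(i < n) _.
  rewrite (_ : \1_(U `|` A n) = (fun x => Num.max (\1_U x) (\1_(A n) x))).
    exact: approximable_max.
  apply/funext => x; rewrite !indicE in_setU.
  by case: (x \in U); case: (x \in A n); rewrite /= ?maxxx ?(max_l ler01) ?(max_r ler01).
- by apply: measurable_indic; exact: bigcupT_measurable.
- exact: indic_unit.
move=> x; rewrite indicE; case: (boolP (x \in \bigcup_n A n)) => [/set_mem[k _ Akx]|xA].
  apply: cvg_near_cst; near=> n; rewrite indicE mem_set//.
  rewrite -bigcup_mkord; exists k => //=; near: n; exact: nbhs_infty_gt.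
apply: cvg_near_cst; near=> n; rewrite indicE memNset//.
rewrite -bigcup_mkord => -[k _ Akx]; move/negP: xA; apply; apply/mem_set.
by exists k.
Unshelve. all: by end_near. Qed.

(** Half-spaces generate the Borel sets, again because the identity has measurable coordinates for
    the sigma-algebra they generate. *)
Lemma approximable_indic (A : set 'rV[R]_d) : measurable A -> approximable \1_A.
Proof.
pose G : set (set 'rV[R]_d) := [set [set v : 'rV[R]_d | q.2 < v 0 q.1] | q in [set: 'I_d * R]].
have GS : <<s G >> `<=` [set A | approximable \1_A].
  apply: smallest_sub; first exact: sigma_algebra_approximable.
  by move=> _ [[i a] _ <-]; exact: approximable_halfspace.
have mid : measurable_fun setT (id : g_sigma_algebraType G -> 'rV[R]_d).
  apply: measurable_fun_rV => i.
  apply: (measurability _ (RGenOInfty.measurableE R)) => _ [_ [a ->] <-].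
  rewrite setTI; apply: sub_sigma_algebra; exists (i, a) => //=.
  by apply/seteqP; split => v /=; rewrite in_itv/= andbT.
by move=> mA; apply: GS; have := mid measurableT A mA; rewrite setTI preimage_id.
Qed.

Lemma approximable_measurable f : measurable_fun setT f -> (forall x, 0 <= f x <= 1) ->
  approximable f.
Proof.
move=> mf f01.
pose A (c : R) : set 'rV[R]_d := [set x | c <= f x].
have mA c : measurable (A c).
  rewrite (_ : A c = f @^-1` `[c, +oo[%classic); last first.
    by apply/seteqP; split => v /=; rewrite in_itv/= andbT.
  by rewrite -[X in measurable X]setTI; exact: mf.
pose c n k : R := k%:R / n.+1%:R.
(* A staircase below [f], built with maxima since sums would leave [0, 1] along the way. It takes
   [n.+2] levels for the last one to reach 1; the error is then at most [n.+1%:R^-1]. *)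
pose fix s n k x {struct k} : R :=
    if k is k'.+1 then Num.max (s n k' x) (c n k' * \1_(A (c n k')) x) else 0.
have c0 n k : 0 <= c n k by rewrite divr_ge0.
have sle n k x : s n k x <= f x.
  elim: k => [|k IH] /=; first by case/andP: (f01 x).
  rewrite ge_max IH indicE; case: (boolP (x \in _)) => [/set_mem|_]; rewrite ?mulr1//.
  by rewrite mulr0; case/andP: (f01 x).
have sge n K k x : (k < K)%N -> c n k <= f x -> c n k <= s n K x.
  elim: K => // K IH; rewrite ltnS leq_eqVlt => /predU1P[<-|kK] ck /=.
    by rewrite le_max indicE mem_set// mulr1 lexx orbT.
  by rewrite le_max IH.
have sa n k : (k <= n.+2)%N -> approximable (s n k).
  elim: k => [_|k IH kn] /=.
    by apply: approximable_cst; rewrite lexx ler01.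
  apply: approximable_max; first exact: IH (ltnW kn).
  apply: approximable_scale; last exact: approximable_indic.
  by rewrite c0 ler_pdivrMr// mul1r ler_nat -ltnS.
apply: (@approximable_lim (fun n => s n n.+2)) => // [n|x]; first exact: sa.
apply/cvgrPdist_le => e e0; near=> n.
rewrite ger0_norm ?subr_ge0//.
have /andP[fx0 fx1] := f01 x.
have n0 : 0 < n.+1%:R :> R by [].
have := @truncn_itv R (n.+1%:R * f x); rewrite mulr_ge0// => /(_ isT).
set k := Num.truncn _ => /andP[k1 k2].
have kn : (k < n.+2)%N.
  rewrite ltnS -(ler_nat R) (le_trans k1)// ler_piMr//.
have ck : c n k <= f x by rewrite ler_pdivrMr// mulrC.
rewrite lerBlDr (@le_trans _ _ (e + c n k))//; last by rewrite lerD2l sge.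
rewrite -lerBlDr; apply: (@le_trans _ _ n.+1%:R^-1).
  rewrite lerBlDr /c (_ : _ + _ = k.+1%:R / n.+1%:R); last first.
    by rewrite -[k.+1%:R]natr1 mulrDl mul1r addrC.
  by rewrite ler_pdivlMr// mulrC ltW.
rewrite invf_ple ?posrE// ltW//; near: n; apply: filterS (nbhs_infty_gtr e^-1) => n hn.
by rewrite (lt_trans hn)// ltr_nat.
Unshelve. all: by end_near. Qed.

End continuous_density.

Lemma exists_nat_gt {R : realType} (x : R) : exists n : nat, x < n%:R.
Proof. by exists (Num.bound `|x|); rewrite (le_lt_trans (ler_norm x))// archi_boundP. Qed.

(** * Entropy from the Donsker-Varadhan inequality *)

Section donsker_varadhan.
Context {R : realType} {d : nat}.
Variables (P Q : probability 'rV[R]_d R) (K : R).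
Implicit Types f g : 'rV[R]_d -> R.

Definition dv_ineq f : Prop := \int[P]_x f x <= K + ln (\int[Q]_x expR (f x)).

Hypothesis dv_continuous : forall f (M : R), continuous f -> (forall x, `|f x| <= M) -> dv_ineq f.

Lemma mean_expR_gt0 f (M : R) : bmeas f -> (forall x, `|f x| <= M) -> 0 < \int[Q]_x expR (f x).
Proof.
move=> bf fM; apply: (@lt_le_trans _ _ (expR (- M))); first exact: expR_gt0.
have := @mean_itv _ _ _ Q (fun x => expR (f x)) (expR (- M)) (expR M) (bmeas_expR bf) _.
move=> /(_ _)/andP[] // x; rewrite !ler_expR -ler_norml; exact: fM.
Qed.

(** Both sides of the inequality are continuous for convergence in mean among functions with a
    common bound. *)
Lemma dv_bounded f (M : R) : measurable_fun setT f -> (forall x, `|f x| <= M) -> dv_ineq f.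
Proof.
move=> mf fM.
have M0 : 0 <= M by exact: le_trans (fM 0).
(* Positive even for [M = 0], so that [f] can be rescaled to [0, 1] by a division. *)
pose M1 := M + 1; have M10 : 0 < M1 by rewrite ltr_wpDl.
have fM1 x : `|f x| <= M1 by rewrite (le_trans (fM x))// lerDl.
have bf : bmeas f by split => //; exists M.
pose u x := (f x + M1) / (2 * M1).
have M20 : 0 < 2 * M1 by rewrite mulr_gt0.
have mu : measurable_fun setT u.
  by apply: measurable_funM => //; exact: measurable_funD.
have u01 x : 0 <= u x <= 1.
  have := fM1 x; rewrite ler_norml => /andP[h1 h2].
  rewrite divr_ge0 ?(ltW M20)//=; first by rewrite ler_pdivrMr// mul1r; lra.
  by lra.
have fu x : f x = 2 * M1 * u x - M1 by rewrite mulrC divfK ?gt_eqF// addrK.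
have [_ _ ap] := approximable_measurable P Q mu u01.
set I := \int[Q]_x expR (f x).
have I0 : 0 < I by exact: mean_expR_gt0 bf fM.
(* Sum of the two Lipschitz constants: [2 * M1] for the mean under [P], the rest for the logarithm
   of the exponential mean under [Q]. *)
pose C := 2 * M1 + expR M1 * (2 * M1) / I.
have C0 : 0 < C by rewrite addr_gt0// divr_gt0// mulr_gt0// expR_gt0.
rewrite /dv_ineq -/I; apply/ler_addgt0Pr => e e0.
have [v [cv v01 Pv Qv]] := ap (e / C) (divr_gt0 e0 C0).
pose g x := 2 * M1 * v x - M1.
have gM1 x : `|g x| <= M1.
  have /andP[v0 v1] := v01 x; rewrite ler_norml /g; apply/andP; split.
    by rewrite lerBrDl addrN mulr_ge0// ltW.
  by rewrite lerBlDr -mulr2n -[M1 *+ 2]mulr_natl ler_piMr// ltW.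
have cg : continuous g.
  move=> x; apply: (@continuous_comp _ _ _ v (fun t : R => 2 * M1 * t - M1)); first exact: cv.
  apply: cvgB; last exact: cvg_cst.
  by apply: cvgM; [exact: cvg_cst|exact: cvg_id].
have bg := bmeas_continuous cg gM1.
have bu := bmeas_itv mu u01; have bv := bmeas_continuous cv (fun x => _ : `|v x| <= 1).
have {}bv : bmeas v.
  by apply: bv => x; have /andP[v0 v1] := v01 x; rewrite ger0_norm.
have buv : bmeas (fun x => `|u x - v x|) by apply: bmeas_norm; exact: bmeasB.
have fg x : f x - g x = 2 * M1 * (u x - v x) by rewrite fu /g; ring.
have h1 : \int[P]_x f x <= \int[P]_x g x + 2 * M1 * (e / C).
  apply: (@le_trans _ _ (\int[P]_x (g x + 2 * M1 * `|u x - v x|))).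
    apply: le_mean => //; first by apply: bmeasD => //; exact: bmeasZ.
    by move=> x; rewrite -lerBlDl fg ler_wpM2l ?(ltW M20)// ler_norm.
  rewrite meanD//; last exact: bmeasZ.
  by rewrite meanZ// lerD2l ler_wpM2l// ltW.
have h2 : \int[Q]_x expR (g x) <= I + expR M1 * (2 * M1) * (e / C).
  apply: (@le_trans _ _ (\int[Q]_x (expR (f x) + expR M1 * (2 * M1) * `|u x - v x|))).
    apply: le_mean; first exact: bmeas_expR.
      by apply: bmeasD; [exact: bmeas_expR|exact: bmeasZ].
    move=> x; rewrite -lerBlDl -mulrA -[2 * M1]ger0_norm ?(ltW M20)// -normrM -fg.
    have h : expR (g x) * (1 + (f x - g x)) <= expR (f x).
      have := expR_ge1Dx (f x - g x); move/(ler_wpM2l (expR_ge0 (g x))).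
      by rewrite -expRD subrKC.
    apply: (@le_trans _ _ (expR (g x) * `|f x - g x|)).
      have := ler_norm (- (f x - g x)); rewrite normrN => /(ler_wpM2l (expR_ge0 (g x))).
      move: h; rewrite mulrDr mulr1 mulrN; lra.
    by rewrite ler_wpM2r// ler_expR (le_trans (ler_norm _)).
  rewrite meanD; [|exact: bmeas_expR|exact: bmeasZ].
  rewrite -/I lerD2l meanZ// ler_wpM2l// mulr_ge0 ?expR_ge0// ltW//.
have h3 := dv_continuous cg gM1; rewrite /dv_ineq in h3.
set J := \int[Q]_x expR (g x) in h2 h3.
have J0 : 0 < J by exact: mean_expR_gt0 bg gM1.
have h4 : ln J <= ln I + expR M1 * (2 * M1) / I * (e / C).
  apply: (le_trans (ln_le_div I0 J0)); rewrite lerD2l lerBlDr ler_pdivrMr//.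
  by rewrite [leRHS]mulrDl mul1r [leRHS]addrC [_ / I * _]mulrAC divfK ?gt_eqF.
have eC : 2 * M1 * (e / C) + expR M1 * (2 * M1) / I * (e / C) = e.
  by rewrite -mulrDl -/C mulrC divfK// gt_eqF.
apply: (le_trans h1).
apply: (le_trans (lerD (le_trans h3 (lerD (lexx K) h4)) (lexx _))).
by rewrite [K + (ln I + _)]addrA -[leLHS]addrA [_ + 2 * M1 * _]addrC eC.
Qed.

(** On a [Q]-null set [A], the test function [n%:R * \1_A] has exponential mean 1, so [n%:R] times
    the mass of [A] under [P] is at most [K] for every [n]. *)
Lemma dv_dominates : P `<< Q.
Proof.
apply/null_content_dominatesP => A mA QA0.
have PAfin : P A = (fine (P A))%:E by rewrite fineK// fin_num_measure.
have ind (m : probability 'rV[R]_d R) : \int[m]_x \1_A x = fine (m A).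
  by rewrite /Rintegral integral_indic// setIT.
have bA : bmeas (\1_A : 'rV[R]_d -> R).
  by apply: (@bmeas_itv _ _ _ _ 0 1); [exact: measurable_indic|exact: indic_unit].
have h (n : nat) : n%:R * fine (P A) <= K.
  have := @dv_bounded (fun x => n%:R * \1_A x) n%:R.
  rewrite /dv_ineq meanZ// ind => /(_ _ _).
  have -> : (fun x : 'rV[R]_d => expR (n%:R * \1_A x) : R) =
      (fun x => 1 + (expR n%:R - 1) * \1_A x).
    apply/funext => x; rewrite indicE; case: (_ \in _) => /=.
      by rewrite !mulr1 addrC subrK.
    by rewrite !mulr0 addr0 expR0.
  rewrite meanD; [|exact: bmeas_cst|exact: bmeasZ].
  rewrite mean_cst meanZ// ind QA0 /= mulr0 addr0 ln1 addr0; apply.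
    by apply: measurable_funM => //; exact: measurable_indic.
  move=> x; have /andP[a0 a1] := indic_unit A x.
  by rewrite ger0_norm ?mulr_ge0// ler_piMr.
rewrite PAfin; apply/eqP; rewrite eqe eq_le; apply/andP; split; last exact: fine_ge0.
rewrite leNgt; apply/negP => a0.
have [n] := exists_nat_gt (K / fine (P A)); rewrite ltr_pdivrMr// => hb.
by have := lt_le_trans hb (h _); rewrite ltxx.
Qed.

Let dom : charge_of_finite_measure P `<< Q. Proof. exact: dv_dominates. Qed.

Let p := Radon_Nikodym (charge_of_finite_measure P) Q.
Let r x : R := fine (p x).
(** The optimal test function is the logarithm of the density; [a_] and [b_] truncate its positive
    and negative parts. Where [r x <= 0], [ln] returns 0 but [lne] returns minus infinity, hence the
    value [l%:R] of [b_] there. *)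
Let a_ (m : nat) x : R := Num.min (Num.max (ln (r x)) 0) m%:R.
Let b_ (l : nat) x : R := if 0 < r x then Num.min (Num.max (- ln (r x)) 0) l%:R else l%:R.

Let pE x : p x = (r x)%:E.
Proof. by rewrite fineK//; exact: Radon_Nikodym_fin_num. Qed.

Let mr : measurable_fun setT r.
Proof.
apply: measurableT_comp => //; apply: (measurable_int Q).
exact: Radon_Nikodym_integrable.
Qed.

Let mlnr : measurable_fun setT (fun x => ln (r x)).
Proof. exact: (measurableT_comp (@measurable_ln R) mr). Qed.

Let ma m : measurable_fun setT (a_ m).
Proof.
by apply: measurable_minr => //; apply: measurable_maxr.
Qed.

Let mb l : measurable_fun setT (b_ l).
Proof.
apply: measurable_fun_ifT => //.
  by apply: measurable_fun_ltr; [exact: measurable_cst|exact: mr].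
apply: measurable_minr => //; apply: measurable_maxr => //.
exact: measurableT_comp.
Qed.

Let a_itv m x : 0 <= a_ m x <= m%:R.
Proof. by rewrite /a_ le_min le_max lexx orbT ler0n ge_min lexx orbT. Qed.

Let b_itv l x : 0 <= b_ l x <= l%:R.
Proof.
rewrite /b_; case: ifP => _; last by rewrite ler0n lexx.
by rewrite le_min le_max lexx orbT ler0n ge_min lexx orbT.
Qed.

Let ba m : bmeas (a_ m). Proof. exact: bmeas_itv (ma m) (a_itv m). Qed.
Let bb l : bmeas (b_ l). Proof. exact: bmeas_itv (mb l) (b_itv l). Qed.

(** [r] comes from the derivative of a charge and is not known to be nonnegative at every point; the
    integral is the mass under [P] of the set where it is. *)
Let int_pos_part : (\int[Q]_x (Num.max (r x) 0)%:E <= 1)%E.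
Proof.
pose D := [set x | 0 <= r x].
have mD : measurable D.
  rewrite (_ : D = r @^-1` `[0, +oo[%classic).
    by rewrite -[X in measurable X]setTI; exact: mr.
  by apply/seteqP; split => x /=; rewrite in_itv/= andbT.
rewrite (_ : (fun x => (Num.max (r x) 0)%:E) = p \_ D).
  rewrite -integral_mkcond -(Radon_Nikodym_integral dom)//.
  exact: probability_le1.
apply/funext => x; rewrite patchE pE; case: ifPn => [/set_mem|/negP xD].
  by move=> /= r0; rewrite max_l.
by rewrite max_r//; apply/ltW; rewrite ltNge; apply/negP => r0; apply: xD; apply/mem_set.
Qed.

(** Truncating the logarithm from above only lowers the exponential; truncating it from below raises
    it to at most [expR (- l%:R)]. *)
Let exp_ab m l x : expR (a_ m x - b_ l x) <= Num.max (r x) 0 + expR (- l%:R).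
Proof.
rewrite /a_ /b_; case: ifPn => r0; last first.
  have r0' : r x <= 0 by rewrite leNgt.
  by rewrite ln0// maxxx min_l// sub0r lerDr le_max lexx orbT.
have el : 0 <= expR (- l%:R : R) by exact: expR_ge0.
have l0 : 0 <= l%:R :> R by [].
rewrite (max_l (ltW r0)); have [lr|lr] := leP 0 (ln (r x)).
  rewrite (max_r (_ : - ln (r x) <= 0)) ?oppr_le0// (min_l l0) subr0.
  rewrite (@le_trans _ _ (expR (ln (r x))))//.
    by rewrite ler_expR ge_min lexx.
  by rewrite lnK ?posrE// lerDl.
rewrite min_l// sub0r (max_l (_ : 0 <= - ln (r x))); last by rewrite oppr_ge0 ltW.
have [h|h] := leP (- ln (r x)) l%:R.
  by rewrite opprK lnK ?posrE// lerDl.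
by rewrite lerDr ltW.
Qed.

Let mean_a_le m l : \int[P]_x a_ m x <= K + expR (- l%:R) + \int[P]_x b_ l x.
Proof.
have bab : bmeas (fun x => a_ m x - b_ l x) by exact: bmeasB.
have [mab [M abM]] := bab.
have := dv_bounded mab abM; rewrite /dv_ineq meanB// lerBlDr => /le_trans; apply.
rewrite lerD2r lerD2l.
have be := bmeas_expR bab.
have h : \int[Q]_x expR (a_ m x - b_ l x) <= 1 + expR (- l%:R).
  rewrite -lee_fin EFin_mean//.
  apply: (@le_trans _ _ (\int[Q]_x ((Num.max (r x) 0)%:E + (expR (- l%:R))%:E))%E).
    apply: ge0_le_integral => //.
    - by apply/measurable_EFinP; case: be.
    - by apply: emeasurable_funD => //; apply/measurable_EFinP; exact: measurable_maxr.
    - by move=> x _; rewrite -EFinD lee_fin; exact: exp_ab.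
  rewrite ge0_integralD//; last 2 first.
  - by move=> x _; rewrite lee_fin le_max lexx orbT.
  - by apply/measurable_EFinP; exact: measurable_maxr.
  rewrite EFinD; apply: leeD => //.
  rewrite integral_cst// [X in (_ * X)%E](_ : _ = 1%E) ?mule1//; exact: probability_setT.
have e0 := expR_gt0 (- l%:R : R).
apply: (@le_trans _ _ (ln (1 + expR (- l%:R)))).
  rewrite ler_ln ?posrE ?addr_gt0//; exact: mean_expR_gt0 bab abM.
by apply: le_ln1Dx; rewrite (lt_trans _ e0)// oppr_lt0.
Qed.

(** In [mean_a_le], the level [m] is kept fixed while a large [l] makes the error [expR (- l%:R)]
    negligible; monotone convergence in [m] comes last. *)
Lemma dv_entropy : (relative_entropy P Q <= K%:E)%E.
Proof.
rewrite /relative_entropy; case: asboolP => [_|]; last by move=> []; exact: dv_dominates.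
rewrite -/p integralE.
set A := (\int[P]_x _)%E; set J := (\int[P]_x (fun _ => _)^\- _)%E.
have aA : A = limn (fun m => \int[P]_x (a_ m x)%:E)%E.
  rewrite -monotone_convergence//.
  - apply: eq_integral => x _; apply/esym/cvg_lim => //.
    rewrite funeposE pE /lne; case: ifPn => r0.
      rewrite (max_r (leNye _)); apply: cvg_near_cst; near=> m.
      by rewrite /a_ ln0// maxxx min_l.
    rewrite -EFin_max; apply: cvg_near_cst; near=> m.
    rewrite /a_ min_l//; near: m; apply: filterS (nbhs_infty_gtr (Num.max (ln (r x)) 0)) => m.
    exact: ltW.
  - by move=> m; apply/measurable_EFinP.
  - by move=> m x _; rewrite lee_fin; case/andP: (a_itv m x).
  - move=> x _ m n mn; rewrite lee_fin /a_ le_min ge_min lexx/=.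
    by rewrite ge_min ler_nat mn orbT.
have b_nd : {homo (fun l => \int[P]_x (b_ l x)%:E)%E : m n / (m <= n)%N >-> (m <= n)%E}.
  move=> m n mn; apply: ge0_le_integral => //.
  - by move=> x _; rewrite lee_fin; case/andP: (b_itv m x).
  - exact/measurable_EFinP.
  - exact/measurable_EFinP.
  - move=> x _; rewrite lee_fin /b_; case: ifP => _; last by rewrite ler_nat.
    by rewrite le_min ge_min lexx/= ge_min ler_nat mn orbT.
have bJ l : (\int[P]_x (b_ l x)%:E <= J)%E.
  have -> : J = limn (fun l => \int[P]_x (b_ l x)%:E)%E.
    rewrite -monotone_convergence//.
    - apply: eq_integral => x _; apply/esym/cvg_lim => //.
      rewrite funenegE pE /lne; case: ifPn => r0.
        rewrite /= (max_l (leey _)); apply/cvgeryP; apply: cvg_trans (@cvgr_idn R).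
        by apply: near_eq_cvg; near=> m; rewrite /b_ ltNge r0.
      rewrite -EFinN -EFin_max; apply: cvg_near_cst; near=> m.
      rewrite /b_ ltNge r0 min_l//; near: m.
      by apply: filterS (nbhs_infty_gtr (Num.max (- ln (r x)) 0)) => m; exact: ltW.
    - by move=> m; apply/measurable_EFinP.
    - by move=> m x _; rewrite lee_fin; case/andP: (b_itv m x).
    - move=> x _ m n mn; rewrite lee_fin /b_; case: ifP => _; last by rewrite ler_nat.
      by rewrite le_min ge_min lexx/= ge_min ler_nat mn orbT.
  apply: lime_ge; first exact: ereal_nondecreasing_is_cvgn.
  by near=> n; apply: b_nd; near: n; exact: nbhs_infty_ge.
have J0 : (0 <= J)%E by apply: integral_ge0 => x _; exact: funeneg_ge0.
(* An infinite negative part makes the difference minus infinity by convention, whatever [A] is. *)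
have [->|Joo] := eqVneq J +oo%E; first by rewrite addeNy leNye.
have Jfin : J \is a fin_num by rewrite ge0_fin_numE// lt_neqAle Joo leey.
rewrite leeBlDr// aA; apply: lime_le.
  apply: ereal_nondecreasing_is_cvgn => m n mn.
  apply: ge0_le_integral => //.
  - by move=> x _; rewrite lee_fin; case/andP: (a_itv m x).
  - by apply/measurable_EFinP.
  - by apply/measurable_EFinP.
  - move=> x _; rewrite lee_fin /a_ le_min ge_min lexx/=.
    by rewrite ge_min ler_nat mn orbT.
apply: nearW => m; rewrite -EFin_mean//.
apply/lee_addgt0Pr => e e0.
have [l le] : exists l : nat, expR (- l%:R) <= e :> R.
  have [l hl] := exists_nat_gt (- ln e); exists l.
  by rewrite -[leRHS]lnK ?posrE// ler_expR lerNl ltW.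
rewrite -(fineK Jfin) -!EFinD lee_fin (le_trans (mean_a_le m l))//.
rewrite [leRHS]addrAC lerD ?lerD2l//.
rewrite -lee_fin (fineK Jfin) EFin_mean//; exact: bJ.
Unshelve. all: by end_near. Qed.

End donsker_varadhan.

(** * Wasserstein distance and limit of the cost *)

Section wasserstein.
Context {R : realType} {d : nat}.
Variables (mu nu : probability 'rV[R]_d R).

(** An optimal coupling is not assumed to exist: every [w] strictly above the distance admits a
    coupling of cost at most [w ^+ 2], and [w] decreases to the distance. Such a [w] is positive
    even at distance 0, so it can serve as a divisor. *)
Lemma entropy_le_W2 (e : \bar R) (kappa lam m : R) : 0 < kappa -> 0 < lam -> 0 <= m ->
  (forall (w : R) g, 0 < w -> coupling mu nu g ->
     (\int[g]_p (enorm (p.1 - p.2) ^+ 2)%:E <= (w ^+ 2)%:E)%E ->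
     (e <= (kappa * (lam * w + m) ^+ 2)%:E)%E) ->
  (e <= kappa%:E * (lam%:E * W2 mu nu + m%:E) ^+ 2)%E.
Proof.
move=> k0 l0 m0 H; rewrite /W2; set S := [set _ | _ in _].
have S0 : (0 <= ereal_inf S)%E.
  by apply: le_ereal_inf_tmp => _ [g _ <-]; apply: integral_ge0 => p _; rewrite lee_fin sqr_ge0.
case E : (ereal_inf S) S0 => [i| |] // S0; last first.
  (* An infinite distance makes the right-hand side infinite, since [kappa] and [lam] are
     positive. *)
  rewrite poweRyr ?invr_eq0 ?pnatr_eq0// gt0_muley ?lte_fin// addye//.
  by rewrite expe2 mulyy gt0_muley ?leey// lte_fin.
rewrite lee_fin in S0; rewrite poweR_EFin powR12_sqrt//; set s := Num.sqrt i.
change (e <= (kappa * (lam * s + m) ^+ 2)%:E)%E.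
apply/lee_addgt0Pr => r r0.
have lim : kappa * (lam * w + m) ^+ 2 @[w --> s^'+] --> kappa * (lam * s + m) ^+ 2.
  apply: cvg_at_right_filter; apply: cvgM; first exact: cvg_cst.
  have c : lam * w + m @[w --> s] --> lam * s + m.
    apply: cvgD; last exact: cvg_cst.
    by apply: cvgM; [exact: cvg_cst|exact: cvg_id].
  by rewrite expr2; apply: cvgM.
have [w [sw wr]] : exists w, s < w /\ kappa * (lam * w + m) ^+ 2 <= kappa * (lam * s + m) ^+ 2 + r.
  have hn := (@cvgrPdist_le _ _ _ _ (at_right_proper_filter s) _ _).1 lim _ r0.
  apply: (@filter_ex _ (s^'+)); near=> w; split; first by near: w; exact: nbhs_right_gt.
  have : `|kappa * (lam * s + m) ^+ 2 - kappa * (lam * w + m) ^+ 2| <= r by near: w.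
  by rewrite ler_norml => /andP[h _]; rewrite -lerBlDl -(opprB (kappa * _)) lerNl.
have w0 : 0 < w by apply: le_lt_trans sw; exact: sqrtr_ge0.
have iw : (ereal_inf S < (w ^+ 2)%:E)%E.
  by rewrite E lte_fin -(sqr_sqrtr S0) ltr_pXn2r ?nnegrE ?sqrtr_ge0 ?(ltW w0).
have [_ [g cg <-] gw] := ereal_inf_lt iw.
apply: (le_trans (H w g w0 cg (ltW gw))); by rewrite -EFinD lee_fin.
Unshelve. all: by end_near. Qed.

Lemma mean_coupling (g : probability ('rV[R]_d * 'rV[R]_d)%type R) (f1 f2 : 'rV[R]_d -> R)
    (w A C : R) : coupling mu nu g ->
  (\int[g]_p (enorm (p.1 - p.2) ^+ 2)%:E <= (w ^+ 2)%:E)%E ->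
  bmeas f1 -> bmeas f2 -> 0 <= A ->
  (forall x y, f1 x - f2 y <= A * enorm (x - y) ^+ 2 + C) ->
  \int[mu]_x f1 x - \int[nu]_y f2 y <= A * w ^+ 2 + C.
Proof.
move=> cg gw b1 b2 A0 H.
have e1 : \int[g]_p f1 p.1 = \int[mu]_x f1 x.
  apply: (mean_law measurable_fst) => // D mD.
  by rewrite -(cg D mD).1; congr (g _); apply/seteqP; split => -[x y] //= [].
have e2 : \int[g]_p f2 p.2 = \int[nu]_x f2 x.
  apply: (mean_law measurable_snd) => // D mD.
  by rewrite -(cg D mD).2; congr (g _); apply/seteqP; split => -[x y] //= [].
have bb1 := bmeas_comp b1 (@measurable_fst _ _ 'rV[R]_d 'rV[R]_d).
have bb2 := bmeas_comp b2 (@measurable_snd _ _ 'rV[R]_d 'rV[R]_d).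
rewrite -e1 -e2 -meanB//.
pose q (p : 'rV[R]_d * 'rV[R]_d) : R := enorm (p.1 - p.2) ^+ 2.
have mq : measurable_fun setT q.
  rewrite (_ : q = fun p => \sum_(i < d) (p.1 0 i - p.2 0 i) ^+ 2); last first.
    by apply/funext => p; rewrite /q enorm_sqr; apply: eq_bigr => i _; rewrite !mxE expr2.
  apply: measurable_sum => i; apply: measurable_funX; apply: measurable_funB.
    exact: (measurableT_comp (@measurable_coord_rV R d i) measurable_fst).
  exact: (measurableT_comp (@measurable_coord_rV R d i) measurable_snd).
have iq : g.-integrable setT (EFin \o q).
  apply/integrableP; split; first exact/measurable_EFinP.
  under eq_integral do rewrite /= ger0_norm ?sqr_ge0//.
  exact: le_lt_trans gw (ltry _).
have iR : g.-integrable setT (EFin \o (fun p => A * q p + C)).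
  apply: (integrable_EFinD measurableT (integrable_EFinZ measurableT A iq)).
  exact: (bmeas_integrable g (bmeas_cst C)).
apply: (@le_trans _ _ (\int[g]_p (A * q p + C))).
  apply: le_Rintegral => //; first exact: (bmeas_integrable g (bmeasB bb1 bb2)).
rewrite (RintegralD measurableT (integrable_EFinZ measurableT A iq) (bmeas_integrable g (bmeas_cst C))).
rewrite mean_cst lerD2r RintegralZl// ler_wpM2l// -lee_fin /Rintegral fineK//.
exact: integrable_fin_num.
Qed.

End wasserstein.

Section geometric_limits.
Context {R : realType}.
Variables (T : R) (T0 : 0 < T).

Lemma cvg_step : T / N.+1%:R @[N --> \oo] --> (0 : R).
Proof.
rewrite -(mulr0 T); apply: cvgM; first exact: cvg_cst.
exact: cvg_harmonic.
Qed.

(** A Riemann sum for the integral of [exp (- c t)] over [0, T], with a rate that may vary with the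
    step. After summing the geometric series, the squeeze comes from
    [u * exp (- u) <= 1 - exp (- u) <= u]. *)
Lemma cvg_riemann_gsum (b : R^nat) (c : R) : b @ \oo --> c -> 0 < c ->
  T / N.+1%:R * gsum (expR (- (b N * (T / N.+1%:R)))) N.+1 @[N --> \oo] -->
    (1 - expR (- (c * T))) / c.
Proof.
move=> bc c0.
pose u N := b N * (T / N.+1%:R).
have u0 : u N @[N --> \oo] --> (0 : R).
  by rewrite -(mulr0 c); apply: cvgM => //; exact: cvg_step.
have E : \forall N \near \oo, 0 < b N.
  by near=> N; near: N; exact: (cvgr_gt _ bc).
have expE N : expR (- u N) ^+ N.+1 = expR (- (b N * T)).
  rewrite -expRM_natl; congr expR; rewrite mulrN /u; congr (- _).
  by rewrite mulrC -mulrA divfK ?pnatr_eq0.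
have limT : (1 - expR (- (b N * T))) @[N --> \oo] --> 1 - expR (- (c * T)).
  apply: cvgB; first exact: cvg_cst.
  apply: (cvg_comp _ expR); last exact: continuous_expR.
  by apply: cvgN; apply: cvgM => //; exact: cvg_cst.
have bV : (b N)^-1 @[N --> \oo] --> c^-1 by apply: cvgV => //; rewrite gt_eqF.
have lo : (1 - expR (- (b N * T))) / b N @[N --> \oo] --> (1 - expR (- (c * T))) / c.
  exact: cvgM.
have hi : (1 - expR (- (b N * T))) / b N * expR (u N) @[N --> \oo] --> (1 - expR (- (c * T))) / c.
  rewrite -[X in _ --> X]mulr1; apply: cvgM => //; rewrite -expR0.
  by apply: (cvg_comp _ expR) u0 _; exact: continuous_expR.
apply: (squeeze_cvgr _ lo hi); near=> N.
have bN : 0 < b N by near: N.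
have h0 : 0 < T / N.+1%:R by rewrite divr_gt0.
have uN : 0 < u N by rewrite mulr_gt0.
have D0 : 0 < 1 - expR (- u N) by rewrite subr_gt0 expR_lt1 oppr_lt0.
have gE : gsum (expR (- u N)) N.+1 = (1 - expR (- (b N * T))) / (1 - expR (- u N)).
  rewrite -expE /gsum; apply: (@mulIf _ (1 - expR (- u N))); first by rewrite gt_eqF.
  rewrite divfK ?gt_eqF// mulrC -[RHS]opprB -[in LHS](opprB _ 1) mulNr.
  by rewrite -subrX1.
rewrite -/(u N) gE.
have A0 : 0 <= 1 - expR (- (b N * T)).
  by rewrite subr_ge0 -expR0 ler_expR oppr_le0 mulr_ge0// ltW.
have -> : T / N.+1%:R * ((1 - expR (- (b N * T))) / (1 - expR (- u N))) =
  (1 - expR (- (b N * T))) * (T / N.+1%:R / (1 - expR (- u N))) by rewrite mulrCA.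
rewrite -[X in _ <= _ <= X]mulrA; apply/andP; split; apply: ler_wpM2l => //.
  rewrite ler_pdivlMr// ler_pdivrMl// -/(u N).
  by have := expR_ge1Dx (- u N); lra.
rewrite ler_pdivrMr// -mulrA ler_pdivlMl// -/(u N).
by have := expR_ge1Dx (u N); rewrite mulrBr mulr1 -expRD subrr expR0; lra.
Unshelve. all: by end_near. Qed.

End geometric_limits.

Lemma gradD {R : realType} {d : nat} (V H : 'rV[R]_d -> R) : C2 V -> C2 H ->
  grad (fun x => V x + H x) = (fun x => grad V x + grad H x).
Proof.
move=> [dV _ _] [dH _ _]; apply/funext => x; apply/rowP => i; rewrite !mxE.
by rewrite -[LHS]/('D_(delta_mx 0 i) (V \+ H) x) deriveD//; exact: diff_derivable.
Qed.

(** The cross term is bounded by [2 r <= r^2 / w + w], an equality at [r = w]. The right-hand side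
    is affine in [r ^+ 2], as [mean_coupling] requires. *)
Lemma sqr_cost_split {R : realFieldType} (lam m w r : R) : 0 < w -> 0 <= lam -> 0 <= m ->
  (lam * r + m) ^+ 2 <= (lam ^+ 2 + lam * m / w) * r ^+ 2 + (lam * m * w + m ^+ 2).
Proof.
move=> w0 l0 m0.
have -> : (lam ^+ 2 + lam * m / w) * r ^+ 2 + (lam * m * w + m ^+ 2) =
    (lam * r + m) ^+ 2 + lam * m * (r - w) ^+ 2 / w by field; rewrite gt_eqF.
by rewrite lerDl divr_ge0 ?(ltW w0)// (mulr_ge0 (mulr_ge0 l0 m0))// sqr_ge0.
Qed.

Section cost_limit.
Context {R : realType}.
Variables (alpha beta L T : R).
Hypothesis T0 : 0 < T.

Definition step_rate (h : R) : R := alpha * (1 - h * beta / 2).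
Definition step_ratio (h : R) : R := expR (- (step_rate h * h)).

Lemma step_rate_cvg : step_rate (T / N.+1%:R) @[N --> \oo] --> alpha.
Proof.
rewrite -[X in _ --> X]mulr1; apply: cvgM; first exact: cvg_cst.
rewrite -[X in _ --> X]subr0; apply: cvgB; first exact: cvg_cst.
rewrite -[X in _ --> X](mul0r (beta / 2)); under eq_fun do rewrite -mulrA.
by apply: cvgM; [exact: cvg_step|exact: cvg_cst].
Qed.

(** For [alpha = 0] the contraction factor is exactly 1 at every step size, so the cost does not
    depend on [N]. *)
Lemma harnack_cost_cvg0 (w : R) : alpha = 0 ->
  harnack_cost (step_ratio (T / N.+1%:R)) (T / N.+1%:R) (2 * L * (T / N.+1%:R)) N.+1 w
    @[N --> \oo] --> (w + 2 * L * T) ^+ 2 / (4 * T).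
Proof.
move=> a0; rewrite (_ : (fun _ => _) = fun=> (w + 2 * L * T) ^+ 2 / (4 * T)).
  exact: cvg_cst.
apply/funext => N; have -> : step_ratio (T / N.+1%:R) = 1.
  by rewrite /step_ratio /step_rate a0 !mul0r oppr0 expR0.
rewrite /harnack_cost /gsum /gsum2 !expr1n; under eq_bigr do rewrite expr1n.
under [X in _ / (_ * X)]eq_bigr do rewrite !expr1n.
rewrite sumr_const card_ord mul1r; have n0 : N.+1%:R != 0 :> R by rewrite pnatr_eq0.
have T1 : T != 0 by rewrite gt_eqF.
by congr (_ / _); [congr (_ ^+ 2); congr (_ + _)|]; field.
Qed.

Lemma harnack_cost_cvg (w : R) : 0 < alpha ->
  harnack_cost (step_ratio (T / N.+1%:R)) (T / N.+1%:R) (2 * L * (T / N.+1%:R)) N.+1 w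
    @[N --> \oo] -->
  alpha / (2 * (1 - expR (- 2 * alpha * T))) *
    (expR (- alpha * T) * w + 2 * L / alpha * (1 - expR (- alpha * T))) ^+ 2.
Proof.
move=> a0; have D0 : 0 < 1 - expR (- (2 * alpha * T)).
  by rewrite subr_gt0 expR_lt1 oppr_lt0 !mulr_gt0.
have c1 := cvg_riemann_gsum T0 step_rate_cvg a0.
(* The sum of squares for a ratio is the geometric sum for its square, that is, for twice the
   rate. *)
have c2 : T / N.+1%:R * gsum2 (step_ratio (T / N.+1%:R)) N.+1 @[N --> \oo] -->
    (1 - expR (- (2 * alpha * T))) / (2 * alpha).
  have r2 : 2 * step_rate (T / N.+1%:R) @[N --> \oo] --> 2 * alpha.
    by apply: cvgM; [exact: cvg_cst|exact: step_rate_cvg].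
  have := cvg_riemann_gsum T0 r2 (mulr_gt0 (ltr0Sn _ 1) a0).
  apply: cvg_trans; apply: near_eq_cvg; near=> N; congr (_ * _).
  rewrite /gsum /gsum2; apply: eq_bigr => k _.
  by rewrite -exprM mulnC exprM /step_ratio -(expRM_natl 2); congr (_ ^+ _); congr expR; ring.
have c3 : step_ratio (T / N.+1%:R) ^+ N.+1 @[N --> \oo] --> expR (- (alpha * T)).
  rewrite (_ : (fun N => _) = fun N => expR (- (step_rate (T / N.+1%:R) * T))).
    apply: (cvg_comp _ expR); last exact: continuous_expR.
    by apply: cvgN; apply: cvgM; [exact: step_rate_cvg|exact: cvg_cst].
  apply/funext => N; rewrite /step_ratio -expRM_natl mulrN; congr (expR (- _)).
  by rewrite mulrC -mulrA divfK ?pnatr_eq0.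
have num : step_ratio (T / N.+1%:R) ^+ N.+1 * w +
    2 * L * (T / N.+1%:R * gsum (step_ratio (T / N.+1%:R)) N.+1)
    @[N --> \oo] --> expR (- (alpha * T)) * w + 2 * L * ((1 - expR (- (alpha * T))) / alpha).
  apply: cvgD; first by apply: cvgM => //; exact: cvg_cst.
  by apply: cvgM => //; exact: cvg_cst.
have den : (4 * (T / N.+1%:R * gsum2 (step_ratio (T / N.+1%:R)) N.+1))^-1 @[N --> \oo] -->
    (4 * ((1 - expR (- (2 * alpha * T))) / (2 * alpha)))^-1.
  apply: cvgV; first by rewrite gt_eqF// !mulr_gt0// invr_gt0 mulr_gt0.
  by apply: cvgM => //; exact: cvg_cst.
rewrite !mulNr; move: D0 num den; set D := 1 - expR (- (2 * _ * _)); set E := expR _.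
move=> D0 num den.
have -> : alpha / (2 * D) * (E * w + 2 * L / alpha * (1 - E)) ^+ 2 =
    (E * w + 2 * L * ((1 - E) / alpha)) ^+ 2 * (4 * (D / (2 * alpha)))^-1.
  by field; rewrite !gt_eqF.
under eq_fun do rewrite /harnack_cost -[2 * L * _ * _]mulrA -[4 * _ * _]mulrA expr2.
by rewrite expr2; apply: cvgM => //; exact: cvgM.
Unshelve. all: by end_near. Qed.

End cost_limit.

(** * Integration over couplings and passage to the limit *)

Section entropy_cost.
Context {R : realType} {d : nat}.
Variables (V H : 'rV[R]_d -> R) (alpha beta L : R).
Hypotheses (VC2 : C2 V) (HC2 : C2 H).
Hypotheses (alpha_ge0 : 0 <= alpha) (L_ge0 : 0 <= L) (beta_gt0 : 0 < beta).
Hypothesis hessV : forall x, loewner_le alpha%:M (hess V x) /\ loewner_le (hess V x) beta%:M.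
Hypothesis gradH : forall x, enorm (grad H x) <= L.

Let U (x : 'rV[R]_d) := V x + H x.
Let rho : R -> R := step_ratio alpha beta.

Lemma loc_lipschitz_grad : loc_lipschitz (grad U).
Proof.
by rewrite gradD//; apply: loc_lipschitzD; exact: C2_grad_loc_lipschitz.
Qed.

Lemma euler_drift_contr (h : R) x y : 0 < h -> h * beta <= 1 ->
  enorm (euler_drift (grad U) h x - euler_drift (grad U) h y) <=
  rho h * enorm (x - y) + 2 * L * h.
Proof.
move=> h0 hb; rewrite /euler_drift gradD//.
have -> : x - h *: (grad V x + grad H x) - (y - h *: (grad V y + grad H y)) =
    ((x - h *: grad V x) - (y - h *: grad V y)) + h *: (grad H y - grad H x).
  by apply/rowP => i; rewrite !mxE; ring.
apply: le_trans (enorm_triangle _ _) _; apply: lerD.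
  by rewrite /rho /step_ratio -mulNr; exact: (gradient_step_contr VC2).
rewrite enormZ (gtr0_norm h0) mulrC; apply: ler_wpM2r; first exact: ltW.
apply: le_trans (enorm_triangle _ _) _; rewrite enormN.
by rewrite mulr_natl mulr2n lerD.
Qed.

Lemma rho_itv (h : R) : 0 < h -> h * beta <= 1 -> 0 < rho h <= 1.
Proof.
move=> h0 hb; rewrite /rho /step_ratio expR_gt0 /= -expR0 ler_expR oppr_le0 !mulr_ge0//;
  last exact: ltW.
by lra.
Qed.

Lemma euler_mean_harnack (mu nu : probability 'rV[R]_d R) g (w h M : R) N f :
  0 < h -> h * beta <= 1 -> 0 < w -> coupling mu nu g ->
  (\int[g]_p (enorm (p.1 - p.2) ^+ 2)%:E <= (w ^+ 2)%:E)%E ->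
  bmeas f -> (forall x, `|f x| <= M) ->
  euler_mean U h N.+1 mu f <=
  harnack_cost (rho h) h (2 * L * h) N.+1 w + ln (euler_mean U h N.+1 nu (expR \o f)).
Proof.
move=> h0 hb w0 cg gw bf fM.
have mF := measurable_euler_drift (loc_lipschitz_continuous loc_lipschitz_grad) h.
have rho01 := rho_itv h0 hb.
have delta0 : 0 <= 2 * L * h by rewrite !mulr_ge0// ltW.
have bG : bmeas (expR \o f) by exact: bmeas_expR.
have cG x : expR (- M) <= (expR \o f) x.
  by rewrite /= ler_expR; have := fM x; rewrite ler_norml => /andP[].
have c0 := expR_gt0 (- M).
have bQ := bmeas_iter_euler_op h mF N.+1 bG.
have cQ := iter_euler_op_ge h mF N.+1 bG cG.
rewrite /euler_mean; set Q := euler_op _ _.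
(* Integrating the pointwise inequality produces the [nu]-mean of a logarithm; Jensen's inequality
   moves the logarithm outside. *)
apply: (@le_trans _ _ (harnack_cost (rho h) h (2 * L * h) N.+1 w +
    \int[nu]_y ln (iter N.+1 Q (expR \o f) y))); last first.
  by rewrite lerD2l; exact: mean_ln_le c0 cQ bQ.
rewrite -lerBlDr.
pose K := 4 * h * gsum2 (rho h) N.+1.
have K0 : 0 < K by rewrite !mulr_gt0//; exact: gsum2_gt0.
have lam0 : 0 <= rho h ^+ N.+1 by rewrite exprn_ge0// expR_ge0.
have m0 : 0 <= 2 * L * h * gsum (rho h) N.+1.
  by rewrite mulr_ge0//; apply/ltW/gsum_gt0.
set lam := rho h ^+ N.+1 in lam0; set m := 2 * L * h * gsum (rho h) N.+1 in m0.
(* At [r = w] the split cost equals the original one, so a coupling of cost at most [w ^+ 2] gives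
   exactly the claimed constant. *)
have -> : harnack_cost (rho h) h (2 * L * h) N.+1 w =
    (lam ^+ 2 + lam * m / w) / K * w ^+ 2 + (lam * m * w + m ^+ 2) / K.
  rewrite /harnack_cost -/lam -/m -/K; clearbody lam m K.
  by field; rewrite !gt_eqF.
apply: (mean_coupling cg gw).
- exact: bmeas_iter_euler_op.
- exact: bmeas_ln c0 cQ bQ.
- by rewrite divr_ge0 ?(ltW K0)// addr_ge0 ?sqr_ge0// divr_ge0 ?(ltW w0)// mulr_ge0.
- move=> x y; rewrite lerBlDr.
  have := @euler_log_harnack R d _ h mF h0 (rho h) _ rho01 delta0
    (fun x y => euler_drift_contr x y h0 hb) N (expR \o f) (expR (- M)) x y c0 cG bG.
  rewrite (_ : (fun x => ln ((expR \o f) x)) = f); last by apply/funext => z; rewrite /= expRK.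
  move=> /le_trans; apply; rewrite lerD2r /harnack_cost -/lam -/m -/K.
  rewrite [X in _ <= X + _]mulrAC -mulrDl ler_wpM2r ?invr_ge0 ?(ltW K0)//.
  exact: sqr_cost_split.
Qed.

Variable P_LD : R -> probability 'rV[R]_d R -> probability 'rV[R]_d R.
Hypothesis P_LD_semigroup : langevin_semigroup U P_LD.
Variables (T : R) (T_gt0 : 0 < T) (mu nu : probability 'rV[R]_d R).

Lemma relative_entropy_le g (w K : R) : 0 < w -> coupling mu nu g ->
  (\int[g]_p (enorm (p.1 - p.2) ^+ 2)%:E <= (w ^+ 2)%:E)%E ->
  harnack_cost (rho (T / N.+1%:R)) (T / N.+1%:R) (2 * L * (T / N.+1%:R)) N.+1 w
    @[N --> \oo] --> K ->
  (relative_entropy (P_LD T mu) (P_LD T nu) <= K%:E)%E.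
Proof.
move=> w0 cg gw costK; apply: dv_entropy => f M cf fM; rewrite /dv_ineq.
(* Applied to [mu] and to [nu] with unrelated solutions: only their laws enter the limit. *)
have lim m (phi : 'rV[R]_d -> R) (M' : R) : continuous phi -> (forall x, `|phi x| <= M') ->
    euler_mean U (T / N.+1%:R) N.+1 m phi @[N --> \oo] --> \int[P_LD T m]_x phi x.
  move=> cphi phiM; case: (P_LD_semigroup m) => dO [Om] [P] [F] [B] [X] [sol X0 XT].
  exact: (euler_mean_cvg sol loc_lipschitz_grad T_gt0 X0 (XT _ (ltW T_gt0)) cphi phiM).
have bf := bmeas_continuous cf fM.
have ce : continuous (expR \o f).
  by move=> x; apply: continuous_comp; [exact: cf|exact: continuous_expR].
have eM x : `|(expR \o f) x| <= expR M.
  rewrite ger0_norm ?expR_ge0//= ler_expR.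
  by have := fM x; rewrite ler_norml => /andP[].
have limE := lim nu _ _ ce eM.
have E0 : 0 < \int[P_LD T nu]_x (expR \o f) x by exact: (mean_expR_gt0 _ bf fM).
have limR := @cvgD _ _ _ _ (eventually_filter) _ _ _ _ costK (cvg_comp _ _ limE (continuous_ln E0)).
apply: (ler_cvg_to (lim mu _ _ cf fM) limR); near=> N.
apply: (@euler_mean_harnack mu nu g w _ M N f) => //; first by rewrite divr_gt0.
(* The step condition [h * beta <= 1] holds for all large [N]. *)
near: N; apply: (cvgr_le (0 : R)) => //.
by rewrite -[X in _ --> X](mul0r beta); apply: cvgM; [exact: cvg_step|exact: cvg_cst].
Unshelve. all: by end_near. Qed.

End entropy_cost.

Theorem corollary3p3 (R : realType) (d : nat) (d_gt0 : (0 < d)%N)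
  (V H : 'rV[R]_d -> R) (VC2 : C2 V) (HC2 : C2 H)
  (expNU_integrable : (lebesgue_rV d).-integrable setT
     (fun x : 'rV[R]_d => (expR (- (V x + H x)))%:E))
  (alpha beta L : R) (alpha_ge0 : 0 <= alpha) (L_ge0 : 0 <= L)
  (beta_gt0 : 0 < beta)
  (hessV : forall x : 'rV[R]_d,
     loewner_le alpha%:M (hess V x) /\ loewner_le (hess V x) beta%:M)
  (gradH : forall x : 'rV[R]_d, enorm (grad H x) <= L)
  (P_LD : R -> probability 'rV[R]_d R -> probability 'rV[R]_d R)
  (P_LD_semigroup : langevin_semigroup (fun x => V x + H x) P_LD)
  (T : R) (T_gt0 : 0 < T) (mu nu : probability 'rV[R]_d R)
  (mu_P2 : P2 mu) (nu_P2 : P2 nu) :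
  (alpha = 0 ->
     (relative_entropy (P_LD T mu) (P_LD T nu) <=
      (W2 mu nu + (2 * L * T)%:E) ^+ 2 * ((4 * T)^-1)%:E)%E) /\
  (0 < alpha ->
     (relative_entropy (P_LD T mu) (P_LD T nu) <=
      (alpha / (2 * (1 - expR (- 2 * alpha * T))))%:E *
      ((expR (- alpha * T))%:E * W2 mu nu +
       (2 * L / alpha * (1 - expR (- alpha * T)))%:E) ^+ 2)%E).
Proof.
have bound := relative_entropy_le VC2 HC2 alpha_ge0 L_ge0 beta_gt0 hessV gradH P_LD_semigroup T_gt0.
split=> [a0|a0].
  rewrite muleC -[X in (X + _)%E]mul1e; apply: entropy_le_W2 => //.
  - by rewrite invr_gt0 mulr_gt0.
  - by rewrite !mulr_ge0// ltW.
  - move=> w g w0 cg gw; apply: (bound _ _ _ _ _ w0 cg gw).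
    have -> : (4 * T)^-1 * (1 * w + 2 * L * T) ^+ 2 = (w + 2 * L * T) ^+ 2 / (4 * T).
      by rewrite mul1r mulrC.
    exact: harnack_cost_cvg0.
have D0 : 0 < 1 - expR (- alpha * T) by rewrite subr_gt0 expR_lt1 mulNr oppr_lt0 mulr_gt0.
apply: entropy_le_W2.
- by rewrite divr_gt0// mulr_gt0// subr_gt0 expR_lt1 !mulNr oppr_lt0 !mulr_gt0.
- exact: expR_gt0.
- by rewrite mulr_ge0 ?(ltW D0)// divr_ge0// mulr_ge0.
- move=> w g w0 cg gw; apply: (bound _ _ _ _ _ w0 cg gw).
  exact: harnack_cost_cvg.
Qed.
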